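(* Let $T$ be the theory, in the language with $\in$ and unary function symbols $j$ (total) and $f$ (partial), described in the context. Then $T$ interprets Quine's $\mathsf{NF}$. More precisely, $T$ proves that if $\alpha$ is a limit ordinal witnessing the Movement axiom and $\in'$ is defined on $V_\alpha$ by $$y \in' x \iff y \in j^{-1}(f(x)) \qquad (x,y\in V_\alpha),$$ then $(V_\alpha,\in')$ satisfies every axiom of $\mathsf{NF}$. Consequently, if $T$ is consistent then $\mathsf{NF}$ is consistent.
   Context: $\mathsf{NF}$ (New Foundations) is the first-order theory in the language $\{\in\}$ whose axioms are Extensionality and Stratified Comprehension: for every stratified formula $\varphi$ in which $y$ is not free, $\exists y\,\forall z\,(z\in y\leftrightarrow\varphi)$. A formula is stratified if one can assign integers to its variables so that $u,v$ receive the same integer in each subformula $u=v$, and $v$ receives the integer of $u$ plus one in each subformula $u\in v$. The theory $T$ has the following axioms. (1) All axioms of $\mathsf{ZF}$, where in instances of Separation and Collection the formulas do not use the symbols $f,j$ (values of $f,j$ may occur only as parameters). (2) Injectivity: $f$ is injective on its domain: $f(x)=f(y)\to x=y$. (3) Automorphism: $j$ is an automorphism of the universe, i.e. $j$ is a bijection of the universe onto itself and $\forall x\,\forall y\,(x\in y\leftrightarrow j(x)\in j(y))$. (4) Amenability: for every set $a$, the sets $\{j(x): x\in a\}$ and $\{x: j(x)\in a\}$ exist. (5) Movement: there is a limit ordinal $\alpha$ such that - $V_{j(\alpha)+1}\subset V_\alpha$ (proper subset); - $V_\alpha\subseteq\mathrm{dom}(f)$ and $\{f(x):x\in V_\alpha\}=V_{j(\alpha)+1}$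 (so $f$ restricts to an external bijection from $V_\alpha$ to $V_{j(\alpha)+1}$); - for every $x\subseteq V_\alpha$ the set $\{f(z): z\in x\}$ exists; - for every set $x\subseteq\{\{a,b\}: a,b\in V_{j(\alpha)+1}\}$ the set $\{\{z,u\}:\{f(z),f(u)\}\in x\}$ exists. Here $V_\beta$ denotes the $\beta$-th level of the cumulative hierarchy. The symbols $f$ and $j$ are ''external'': they need not be sets. *)

(* Defs.v *)
From Stdlib Require Import List ZArith Arith.
Import ListNotations.

Set Implicit Arguments.

(** A language adds unary function symbols and binary relation symbols to the
    primitive symbols [=] and [∈].  Variables are de Bruijn indices: [Var n]
    refers to the [n]-th enclosing quantifier, counted from the inside. *)

Record lang := Lang { fsym : Set; rsym : Set }.

Inductive term (L : lang) : Set :=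
| Var : nat -> term L
| App : fsym L -> term L -> term L.

Inductive form (L : lang) : Set :=
| Bot : form L
| Eq  : term L -> term L -> form L
| Mem : term L -> term L -> form L
| Rel : rsym L -> term L -> term L -> form L
| Imp : form L -> form L -> form L
| All : form L -> form L.

Arguments Var {L} _.
Arguments Bot {L}.

Definition Neg {L} (p : form L) := Imp p Bot.
Definition And {L} (p q : form L) := Neg (Imp p (Neg q)).
Definition Or  {L} (p q : form L) := Imp (Neg p) q.
Definition Iff {L} (p q : form L) := And (Imp p q) (Imp q p).
Definition Ex  {L} (p : form L) := Neg (All (Neg p)).

Fixpoint subst_term {L} (s : nat -> term L) (t : term L) : term L :=
  match t with
  | Var n => s n
  | App f u => App f (subst_term s u)
  end.

Definition lift {L} (k : nat) (t : term L) : term L :=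
  subst_term (fun n => Var (n + k)) t.

Definition up {L} (s : nat -> term L) (n : nat) : term L :=
  match n with
  | 0 => Var 0
  | S m => lift 1 (s m)
  end.

Fixpoint subst {L} (s : nat -> term L) (p : form L) : form L :=
  match p with
  | Bot => Bot
  | Eq t u => Eq (subst_term s t) (subst_term s u)
  | Mem t u => Mem (subst_term s t) (subst_term s u)
  | Rel r t u => Rel r (subst_term s t) (subst_term s u)
  | Imp p q => Imp (subst s p) (subst s q)
  | All p => All (subst (up s) p)
  end.

(** Instantiate the variables [0, 1, ...] by the terms of [l]; the remaining
    variables are lowered by [length l]. *)
Definition inst {L} (l : list (term L)) (p : form L) : form L :=
  subst (fun n => nth n l (Var (n - length l))) p.

Fixpoint below_term {L} (n : nat) (t : term L) : Prop :=
  match t with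
  | Var m => m < n
  | App _ u => below_term n u
  end.

(** All free variables of [p] are among [0, ..., n-1]. *)
Fixpoint below {L} (n : nat) (p : form L) : Prop :=
  match p with
  | Bot => True
  | Eq t u => below_term n t /\ below_term n u
  | Mem t u => below_term n t /\ below_term n u
  | Rel _ t u => below_term n t /\ below_term n u
  | Imp p q => below n p /\ below n q
  | All p => below (S n) p
  end.

Definition closure_of {L} (p c : form L) : Prop :=
  exists n, below n p /\ c = Nat.iter n (@All L) p.

Inductive deriv {L} : list (form L) -> form L -> Prop :=
| D_ax   A p : In p A -> deriv A p
| D_impI A p q : deriv (p :: A) q -> deriv A (Imp p q)
| D_impE A p q : deriv A (Imp p q) -> deriv A p -> deriv A q
| D_dn   A p : deriv A (Neg (Neg p)) -> deriv A p
| D_allI A p : deriv (map (subst (fun n => Var (S n))) A) p -> deriv A (All p)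
| D_allE A p t : deriv A (All p) -> deriv A (inst [t] p)
| D_refl A t : deriv A (Eq t t)
| D_leib A p t u :
    deriv A (Eq t u) -> deriv A (inst [t] p) -> deriv A (inst [u] p).

Definition theory (L : lang) := form L -> Prop.

Definition proves {L} (T : theory L) (p : form L) : Prop :=
  exists A, (forall q, In q A -> T q) /\ deriv A p.

Definition consistent {L} (T : theory L) : Prop := ~ proves T Bot.

Declare Scope fo_scope.
Delimit Scope fo_scope with fo.
Open Scope fo_scope.
Notation "$ n" := (Var n) (at level 8, n at level 0, format "$ n") : fo_scope.
Notation "t ↑ k" := (lift k t)
  (at level 7, left associativity, format "t ↑ k") : fo_scope.
Notation "t ≐ u" := (Eq t u) (at level 70) : fo_scope.
Notation "t ∈ u" := (Mem t u) (at level 70) : fo_scope.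
Notation "¬ p" := (Neg p) (at level 75, right associativity) : fo_scope.
Notation "p ⊓ q" := (And p q) (at level 80, right associativity) : fo_scope.
Notation "p ⊔ q" := (Or p q) (at level 85, right associativity) : fo_scope.
Notation "p ⟶ q" := (Imp p q) (at level 90, right associativity) : fo_scope.
Notation "p ⟷ q" := (Iff p q) (at level 95, no associativity) : fo_scope.

(** The set-theoretic abbreviations below take terms living in the ambient
    context; their bodies lift them past the quantifiers they introduce. *)

(** Bounded quantifiers; in the body [p], [$0] is the bound variable. *)
Definition AllIn {L} (a : term L) (p : form L) := All ($0 ∈ a↑1 ⟶ p).
Definition ExIn {L} (a : term L) (p : form L) := Ex ($0 ∈ a↑1 ⊓ p).

Definition subset {L} (a b : term L) := AllIn a ($0 ∈ b↑1).

Definition is_empty {L} (a : term L) := All (¬ $0 ∈ a↑1).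

(** [c = {a, b}] *)
Definition is_pair {L} (c a b : term L) :=
  All ($0 ∈ c↑1 ⟷ $0 ≐ a↑1 ⊔ $0 ≐ b↑1).

(** [c = {{a}, {a, b}}] *)
Definition is_opair {L} (c a b : term L) :=
  All ($0 ∈ c↑1 ⟷ is_pair $0 a↑1 a↑1 ⊔ is_pair $0 a↑1 b↑1).

(** [(a, b) ∈ g] *)
Definition graph {L} (g a b : term L) := ExIn g (is_opair $0 a↑1 b↑1).

(** [s = a ∪ {a}] *)
Definition is_succ {L} (s a : term L) :=
  All ($0 ∈ s↑1 ⟷ $0 ∈ a↑1 ⊔ $0 ≐ a↑1).

Definition transitive {L} (a : term L) := AllIn a (subset $0 a↑1).

(** Von Neumann ordinals (in the presence of Foundation). *)
Definition is_ordinal {L} (a : term L) := transitive a ⊓ AllIn a (transitive $0).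

Definition is_limit {L} (a : term L) :=
  is_ordinal a ⊓ ¬ is_empty a ⊓ AllIn a (ExIn a↑1 (is_succ $0 $1)).

(** [w = ⋃ { P(g(d)) : d ∈ c }] *)
Definition is_stage {L} (g c w : term L) :=
  All ($0 ∈ w↑1 ⟷ ExIn c↑1 (Ex (graph g↑3 $1 $0 ⊓ subset $2 $0))).

(** [v = V_b]: there is a [g], functional on [b + 1], with
    [g(c) = ⋃ { P(g(d)) : d ∈ c }] for all [c ≤ b], and [g(b) = v]. *)
Definition is_V {L} (b v : term L) :=
  Ex (All ($0 ∈ b↑2 ⊔ $0 ≐ b↑2 ⟶
           Ex (All (graph $3 $2 $0 ⟷ $0 ≐ $1) ⊓ is_stage $2 $1 $0))
      ⊓ graph $0 b↑1 v↑1).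

Definition Lset : lang := Lang Empty_set Empty_set.

Definition Extensionality {L} : form L :=
  All (All (All ($0 ∈ $2 ⟷ $0 ∈ $1) ⟶ $1 ≐ $0)).

Definition Foundation : form Lset :=
  All (Ex ($0 ∈ $1) ⟶ ExIn $0 (AllIn $0 (¬ $0 ∈ $2))).

Definition Pairing : form Lset := All (All (Ex (is_pair $0 $2 $1))).

Definition Union : form Lset :=
  All (Ex (All ($0 ∈ $1 ⟷ ExIn $2 ($1 ∈ $0)))).

Definition PowerSet : form Lset :=
  All (Ex (All ($0 ∈ $1 ⟷ subset $0 $2))).

Definition Infinity : form Lset :=
  Ex (ExIn $0 (is_empty $0) ⊓ AllIn $0 (ExIn $1 (is_succ $0 $1))).

(** In [p], [$0] is the element and [$(1+i)] are parameters. *)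
Definition Separation (p : form Lset) : form Lset :=
  All (Ex (All ($0 ∈ $1 ⟷
    $0 ∈ $2 ⊓ subst (fun n => match n with 0 => $0 | S i => $(i + 3) end) p))).

(** In [p x y], [$0] is [y], [$1] is [x] and [$(2+i)] are parameters. *)
Definition Collection (p : form Lset) : form Lset :=
  All (AllIn $0
         (Ex (subst (fun n => match n with
                              | 0 => $0 | 1 => $1 | S (S i) => $(i + 3)
                              end) p))
       ⟶ Ex (AllIn $1
         (ExIn $1 (subst (fun n => match n with
                                   | 0 => $0 | 1 => $1 | S (S i) => $(i + 4)
                                   end) p)))).

Inductive ZF : theory Lset :=
| ZF_ext : ZF Extensionality
| ZF_found : ZF Foundation
| ZF_pair : ZF Pairing
| ZF_union : ZF Union
| ZF_power : ZF PowerSet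
| ZF_inf : ZF Infinity
| ZF_sep p c : closure_of (Separation p) c -> ZF c
| ZF_coll p c : closure_of (Collection p) c -> ZF c.

Definition type_of (s : nat -> Z) (t : term Lset) : Z :=
  match t with
  | Var n => s n
  | App f _ => match f with end
  end.

(** [s] assigns integers to the free variables; each bound variable receives an
    integer at its binder. *)
Fixpoint stratified_by (s : nat -> Z) (p : form Lset) : Prop :=
  match p with
  | Bot => True
  | Eq t u => type_of s t = type_of s u
  | Mem t u => type_of s u = (type_of s t + 1)%Z
  | Rel r _ _ => match r with end
  | Imp p q => stratified_by s p /\ stratified_by s q
  | All p => exists k : Z,
      stratified_by (fun n => match n with 0 => k | S m => s m end) p
  end.

Definition stratified (p : form Lset) : Prop := exists s, stratified_by s p.

(** In [p], [$0] is [z] and [$(1+i)] are parameters; the set [y] being asserted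
    to exist is [$1] below the quantifiers and does not occur in [p]. *)
Definition Comprehension (p : form Lset) : form Lset :=
  Ex (All ($0 ∈ $1 ⟷
    subst (fun n => match n with 0 => $0 | S i => $(i + 2) end) p)).

Inductive NF : theory Lset :=
| NF_ext : NF Extensionality
| NF_compr p c : stratified p -> closure_of (Comprehension p) c -> NF c.

Inductive T_fsym : Set := j_sym.
Inductive T_rsym : Set := f_sym.

Definition LT : lang := Lang T_fsym T_rsym.

Definition j (t : term LT) : term LT := @App LT j_sym t.

(** The partial function symbol [f] is represented by its graph:
    [f x y] means that [f(x)] is defined and equal to [y]. *)
Definition f (t u : term LT) : form LT := @Rel LT f_sym t u.

Definition embed_term {L} (t : term Lset) : term L :=
  match t with
  | Var n => Var n
  | App e _ => match e with end
  end.

Fixpoint embed {L} (p : form Lset) : form L :=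
  match p with
  | Bot => Bot
  | Eq t u => Eq (embed_term t) (embed_term u)
  | Mem t u => Mem (embed_term t) (embed_term u)
  | Rel r _ _ => match r with end
  | Imp p q => Imp (embed p) (embed q)
  | All p => All (embed p)
  end.

Definition f_functional : form LT :=
  All (All (All (f $2 $1 ⟶ f $2 $0 ⟶ $1 ≐ $0))).

Definition f_injective : form LT :=
  All (All (All (f $2 $0 ⟶ f $1 $0 ⟶ $2 ≐ $1))).

Definition j_injective : form LT := All (All (j $1 ≐ j $0 ⟶ $1 ≐ $0)).
Definition j_surjective : form LT := All (Ex (j $0 ≐ $1)).
Definition j_mem : form LT := All (All ($1 ∈ $0 ⟷ j $1 ∈ j $0)).

Definition j_image : form LT :=
  All (Ex (All ($0 ∈ $1 ⟷ ExIn $2 ($1 ≐ j $0)))).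
Definition j_preimage : form LT :=
  All (Ex (All ($0 ∈ $1 ⟷ j $0 ∈ $2))).

(** [f[v] = w], with [f] defined on all of [v] *)
Definition f_maps_onto (v w : term LT) : form LT :=
  AllIn v (Ex (f $1 $0)) ⊓ All ($0 ∈ w↑1 ⟷ ExIn v↑1 (f $0 $1)).

(** for every [x ⊆ v], the set [{f(z) : z ∈ x}] exists *)
Definition f_images (v : term LT) : form LT :=
  All (subset $0 v↑1 ⟶ Ex (All ($0 ∈ $1 ⟷ ExIn $2 (f $0 $1)))).

(** for every [x ⊆ {{a,b} : a, b ∈ w}], the set [{{z,u} : {f(z),f(u)} ∈ x}]
    exists; the quantifiers after the biconditional bind [z], [u], [f(z)],
    [f(u)] and [{f(z),f(u)}], in this order *)
Definition f_pair_preimages (w : term LT) : form LT :=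
  All (AllIn $0 (ExIn w↑2 (ExIn w↑3 (is_pair $2 $1 $0))) ⟶
    Ex (All ($0 ∈ $1 ⟷
      Ex (Ex (Ex (Ex (Ex (
        is_pair $5 $4 $3 ⊓ f $4 $2 ⊓ f $3 $1 ⊓ is_pair $0 $2 $1 ⊓ $0 ∈ $7)))))))).

(** [a] is a limit ordinal as in the Movement axiom; in the body,
    [$2 = V_a], [$1 = j(a) + 1] and [$0 = V_{j(a)+1}]. *)
Definition movement_witness (a : term LT) : form LT :=
  is_limit a ⊓
  Ex (Ex (Ex (
    is_V a↑3 $2 ⊓ is_succ $1 (j a↑3) ⊓ is_V $1 $0 ⊓
    (subset $0 $2 ⊓ ¬ $0 ≐ $2) ⊓
    f_maps_onto $2 $0 ⊓
    f_images $2 ⊓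
    f_pair_preimages $0))).

Definition Movement : form LT := Ex (movement_witness $0).

Inductive T : theory LT :=
| T_zf p : ZF p -> T (embed p)
| T_f_functional : T f_functional
| T_f_injective : T f_injective
| T_j_injective : T j_injective
| T_j_surjective : T j_surjective
| T_j_mem : T j_mem
| T_j_image : T j_image
| T_j_preimage : T j_preimage
| T_movement : T Movement.

(** Translation of {∈}-formulas given a domain formula [dom] ([$0] the element,
    [$1] the parameter) and a formula [mem] for membership of [$0] in [$1], with
    parameter [$2].  The term [a] is the current parameter. *)
Fixpoint translate {L} (dom mem : form L) (a : term L) (p : form Lset) : form L :=
  match p with
  | Bot => Bot
  | Eq t u => Eq (embed_term t) (embed_term u)
  | Mem t u => inst [embed_term t; embed_term u; a] mem
  | Rel r _ _ => match r with end
  | Imp p q => Imp (translate dom mem a p) (translate dom mem a q)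
  | All p => All (inst [$0; a↑1] dom ⟶ translate dom mem a↑1 p)
  end.

(** [T] interprets [S] relative to a domain, with equality interpreted as
    equality, using a parameter ranging over the class defined by [par]. *)
Definition interpretation {L} (T : theory L) (S : theory Lset)
    (par dom mem : form L) : Prop :=
  (below 1 par /\ below 2 dom /\ below 3 mem) /\
  proves T (Ex par) /\
  proves T (All (par ⟶ Ex dom)) /\
  forall p, S p -> proves T (All (par ⟶ translate dom mem $0 p)).

Definition interprets {L} (T : theory L) (S : theory Lset) : Prop :=
  exists par dom mem, interpretation T S par dom mem.

(** [$0 ∈ V_{$1}] *)
Definition in_V {L} : form L := Ex (is_V $2 $0 ⊓ $1 ∈ $0).

(** [$0 ∈ j⁻¹(f($1))]: the bound variable is the [w] with [j(w) = f($1)]. *)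
Definition mem' : form LT := Ex (f $2 (j $0) ⊓ $1 ∈ $0).

(* Main.v *)
From Stdlib Require Import List ZArith Arith Lia Cantor.
From Stdlib Require Import Classical ClassicalEpsilon FunctionalExtensionality.
From Stdlib Require Import PropExtensionality ProofIrrelevance.
Require Import Defs.
Import ListNotations.

(** By [completeness] it is enough to argue in a model of [T]; its proof is Henkin's,
    with variables as the witnesses, which are all at hand because the axioms of
    [T] are closed.  Let [a] witness
    Movement there and let [U = V_a].  Levels of the hierarchy are unique
    ([V_unique]) and [j] is an automorphism, so [V_(j(a)) = j(U)], and
    [V_(j(a)+1)] is the power set of [j(U)] ([V_succ]).  Hence
    [h(x) = j⁻¹(f(x))] is an external bijection from [U] onto the whole power
    set of [U], and the new membership is [y ∈ h(x)] ([movement_bijection]).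

    Extensionality is the injectivity of [h].  As [h] is onto, comprehension
    for [φ] amounts to the class of all [z] in [U] that satisfy [φ] being a set
    of the model.  Separation does not give this at once, since [h] is
    not definable by an ∈-formula; this is where stratification enters.  Let
    [ι(x)] be the element of [U] with [h(ι(x)) = {x}].  The relation between
    [ι^(k+1)(y)] and [ι^k(x)] that holds when [y ∈ h(x)] is a set of the model
    ([definable_mem_at]).  For [k = 0] it is the inverse image under [h] of the
    relation that [A] is a singleton included in [B]; for [k + 1] it is the
    inverse image of the relation between [{c}] and [{d}] where [(c, d)] is in
    the relation for [k].  Movement provides inverse images of sets of unordered
    pairs, and [pull2] and [pull_singletons] recover the order.  Now let [N]
    bound the types used in a stratified [φ], and read each variable [x] of type
    [i] through [ι^(N-i)(x)]: every atomic formula becomes a definable relation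
    of the model, and so does [φ] ([stratified_definable]).  Separation then
    yields the set of all [ι^k(z)] with [z] satisfying [φ], for some [k], and
    images under [h] followed by unions remove the [k] singletons ([lower]).

    For the consistency statement, a consistent [T] has a model
    ([model_existence]), and soundness applies to the model of NF built in it. *)

(** * Substitution *)

Definition scons {X : Type} (x : X) (s : nat -> X) (n : nat) : X :=
  match n with 0 => x | S m => s m end.

Lemma scons_eta (X : Type) (s : nat -> X) : scons (s 0) (fun n => s (S n)) = s.
Proof. extensionality n; now destruct n. Qed.

Section Substitution.
Context {L : lang}.
Implicit Types (s r : nat -> term L) (t u : term L) (p q : form L).

Lemma subst_term_comp s r t :
  subst_term s (subst_term r t) = subst_term (fun n => subst_term s (r n)) t.
Proof. induction t; cbn; congruence. Qed.

Lemma subst_term_var t : subst_term (@Var L) t = t.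
Proof. induction t; cbn; congruence. Qed.

Lemma up_var : up (@Var L) = @Var L.
Proof.
  extensionality n; destruct n; cbn; auto. now rewrite Nat.add_1_r.
Qed.

Lemma subst_var p : subst (@Var L) p = p.
Proof. induction p; cbn; rewrite ?subst_term_var, ?up_var; congruence. Qed.

Lemma subst_lift s t : subst_term s (lift 1 t) = subst_term (fun n => s (S n)) t.
Proof.
  unfold lift; rewrite subst_term_comp. f_equal; extensionality n; cbn.
  now rewrite Nat.add_1_r.
Qed.

Lemma up_comp s r :
  (fun n => subst_term (up s) (up r n)) = up (fun n => subst_term s (r n)).
Proof.
  extensionality n; destruct n; cbn; auto.
  rewrite subst_lift; cbn. unfold lift. now rewrite subst_term_comp.
Qed.

Lemma subst_comp s r p :
  subst s (subst r p) = subst (fun n => subst_term s (r n)) p.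
Proof.
  revert s r; induction p; intros s' r'; cbn;
    rewrite ?subst_term_comp, ?IHp1, ?IHp2, ?IHp, ?up_comp; reflexivity.
Qed.

Lemma inst1 t p : inst [t] p = subst (scons t (@Var L)) p.
Proof.
  unfold inst. f_equal; extensionality n. destruct n as [|n]; cbn; auto.
  rewrite Nat.sub_0_r. now destruct n.
Qed.

Lemma inst_up s t p : inst [t] (subst (up s) p) = subst (scons t s) p.
Proof.
  rewrite inst1, subst_comp. f_equal; extensionality n; destruct n; cbn; auto.
  rewrite subst_lift; cbn. apply subst_term_var.
Qed.

Lemma subst_inst s t p :
  subst s (inst [t] p) = inst [subst_term s t] (subst (up s) p).
Proof.
  rewrite inst_up, inst1, subst_comp. f_equal; extensionality n; now destruct n.
Qed.

Lemma subst_term_below s r t n :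
  below_term n t -> (forall m, m < n -> s m = r m) ->
  subst_term s t = subst_term r t.
Proof. induction t; cbn; intros; auto. f_equal; auto. Qed.

Lemma subst_below s r p n :
  below n p -> (forall m, m < n -> s m = r m) -> subst s p = subst r p.
Proof.
  revert s r n; induction p; cbn; intros s' r' n H E; try destruct H; auto;
    f_equal; eauto using subst_term_below.
  apply IHp with (S n); auto. intros [|m] Hm; cbn; auto.
  rewrite E; auto; lia.
Qed.

Lemma below_term_mono t n m : below_term n t -> n <= m -> below_term m t.
Proof. induction t; cbn; intros; auto; lia. Qed.

Lemma below_mono p n m : below n p -> n <= m -> below m p.
Proof.
  revert n m; induction p; cbn; intros n m H E; try destruct H; eauto using below_term_mono.
  apply IHp with (S n); auto; lia.
Qed.

Lemma below_term_subst s t n m :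
  below_term n t -> (forall i, i < n -> below_term m (s i)) ->
  below_term m (subst_term s t).
Proof. induction t; cbn; auto. Qed.

Lemma below_subst s p n m :
  below n p -> (forall i, i < n -> below_term m (s i)) -> below m (subst s p).
Proof.
  revert s n m; induction p; cbn; intros s n m H E; try destruct H;
    eauto using below_term_subst.
  apply IHp with (S n); auto. intros [|i] Hi; cbn; [lia|].
  apply below_term_subst with m; [apply E; lia|]. intros k Hk; cbn; lia.
Qed.

Lemma below_closure p c : closure_of p c -> below 0 c.
Proof.
  intros (n & H & ->). revert p H; induction n as [|n IH]; intros p H; auto.
  rewrite Nat.iter_succ_r. now apply IH.
Qed.

End Substitution.

(** * Derivations and theories *)

Section Derivations.
Context {L : lang}.
Implicit Types (A B : list (form L)) (p q : form L) (S : theory L).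

Lemma deriv_weaken A B p : deriv A p -> incl A B -> deriv B p.
Proof.
  intros H; revert B; induction H; intros B HB.
  - apply D_ax; auto.
  - apply D_impI, IHderiv. intros x [->|Hx]; cbn; auto.
  - eapply D_impE; eauto.
  - apply D_dn; auto.
  - apply D_allI, IHderiv. now apply incl_map.
  - apply D_allE; auto.
  - apply D_refl.
  - eapply D_leib; eauto.
Qed.

Lemma deriv_subst A p (s : nat -> term L) :
  deriv A p -> deriv (map (subst s) A) (subst s p).
Proof.
  intros H; revert s; induction H; intros s; cbn in *.
  - apply D_ax; now apply in_map.
  - apply D_impI, IHderiv.
  - eapply D_impE; eauto.
  - apply D_dn. apply (IHderiv s).
  - apply D_allI. specialize (IHderiv (up s)).
    rewrite map_map in *. erewrite map_ext; [exact IHderiv|].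
    intros q; cbn. rewrite !subst_comp. f_equal; extensionality n; cbn.
    unfold lift. f_equal; extensionality m. now rewrite Nat.add_1_r.
  - rewrite subst_inst. apply D_allE, IHderiv.
  - apply D_refl.
  - rewrite subst_inst. apply D_leib with (subst_term s t); auto.
    rewrite <- subst_inst; auto.
Qed.

Lemma deriv_absurd A p : deriv A Bot -> deriv A p.
Proof.
  intros H. apply D_dn, D_impI. eapply deriv_weaken; [exact H|]. now right.
Qed.

(** A variable [k] that occurs nowhere else plays the part of a fresh constant:
    the substitution in the proof moves it to position 0 and shifts the others. *)
Lemma deriv_generalize A p k :
  (forall q, In q A -> below k q) -> below k p ->
  deriv A (inst [Var k] p) -> deriv A (All p).
Proof.
  intros HA Hp H. apply D_allI.
  apply deriv_subst with
    (s := fun n => if Nat.eq_dec n k then Var 0 else Var (Datatypes.S n)) in H.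
  replace (map (subst (fun n => Var (Datatypes.S n))) A) with
    (map (subst (fun n => if Nat.eq_dec n k then Var 0 else Var (Datatypes.S n))) A).
  2:{ apply map_ext_in. intros q Hq. apply subst_below with k; auto.
      intros m Hm. destruct (Nat.eq_dec m k); auto; lia. }
  revert H. rewrite inst1, subst_comp.
  rewrite <- (subst_var p) at 2.
  erewrite subst_below with (r := @Var L); [auto|exact Hp|].
  intros [|m] Hm; cbn.
  - destruct (Nat.eq_dec k k); congruence.
  - destruct (Nat.eq_dec m k); auto; lia.
Qed.

Definition add S p : theory L := fun q => S q \/ q = p.

Lemma proves_ax S p : S p -> proves S p.
Proof.
  intros H; exists [p]; split; [intros q [<-|[]]; auto|]. apply D_ax; now left.
Qed.

Lemma proves_mono (S S' : theory L) p :
  (forall q, S q -> S' q) -> proves S p -> proves S' p.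
Proof. intros H (A & HA & D). exists A; auto. Qed.

Lemma proves_deduction S p q : proves (add S p) q -> proves S (Imp p q).
Proof.
  intros (A & HA & D).
  assert (HB : exists B, (forall r, In r B -> S r) /\ incl A (p :: B)).
  { clear D; induction A as [|a A IH].
    - exists []; split; intros x [].
    - destruct (IH (fun r Hr => HA r (or_intror Hr))) as (B & HB & I).
      destruct (HA a (or_introl eq_refl)) as [Ha| ->].
      + exists (a :: B); split; [intros r [<-|Hr]; auto|].
        intros x [<-|Hx]; cbn; auto. destruct (I x Hx); auto.
      + exists B; split; auto. intros x [<-|Hx]; [now left|exact (I x Hx)]. }
  destruct HB as (B & HB & I). exists B; split; auto.
  apply D_impI. eapply deriv_weaken; eauto.
Qed.

Lemma proves_deriv1 S p q : (forall A, deriv A p -> deriv A q) -> proves S p -> proves S q.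
Proof. intros H (A & HA & D). exists A; auto. Qed.

Lemma proves_deriv2 S p q r :
  (forall A, deriv A p -> deriv A q -> deriv A r) ->
  proves S p -> proves S q -> proves S r.
Proof.
  intros H (A & HA & D) (B & HB & E). exists (A ++ B); split.
  - intros x Hx. apply in_app_or in Hx as []; auto.
  - apply H; eapply deriv_weaken; eauto; [apply incl_appl|apply incl_appr]; apply incl_refl.
Qed.

Lemma proves_mp S p q : proves S (Imp p q) -> proves S p -> proves S q.
Proof. apply proves_deriv2. intros; eapply D_impE; eauto. Qed.

Lemma proves_absurd S p : proves S Bot -> proves S p.
Proof. apply proves_deriv1. intros; now apply deriv_absurd. Qed.

Lemma consistent_add_neg S p : ~ proves S p -> consistent (add S (Neg p)).
Proof.
  intros H C. apply H. apply proves_deduction in C.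
  revert C. apply proves_deriv1. intros A D. now apply D_dn.
Qed.

Lemma proves_neg_imp S p q :
  proves S (Neg (Imp p q)) -> proves S p /\ proves S (Neg q).
Proof.
  intros H; split; revert H; apply proves_deriv1; intros A D.
  - apply D_dn, D_impI. apply D_impE with (Imp p q).
    + eapply deriv_weaken; [exact D|]. intros x Hx; now right.
    + apply D_impI. apply deriv_absurd. apply D_impE with p; apply D_ax; cbn; auto.
  - apply D_impI. apply D_impE with (Imp p q).
    + eapply deriv_weaken; [exact D|]. intros x Hx; now right.
    + apply D_impI, D_ax; cbn; auto.
Qed.

End Derivations.

(** * Structures *)

Record structure (L : lang) := Structure {
  dom :> Type;
  fun_of : fsym L -> dom -> dom;
  rel_of : rsym L -> dom -> dom -> Prop;
  mem_of : dom -> dom -> Prop }.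
Arguments fun_of {L s}.
Arguments rel_of {L s}.
Arguments mem_of {L s}.

Fixpoint eval {L} {M : structure L} (e : nat -> M) (t : term L) : M :=
  match t with
  | Var n => e n
  | App g u => fun_of g (eval e u)
  end.

Fixpoint sat {L} {M : structure L} (e : nat -> M) (p : form L) : Prop :=
  match p with
  | Bot => False
  | Eq t u => eval e t = eval e u
  | Mem t u => mem_of (eval e t) (eval e u)
  | Rel r t u => rel_of r (eval e t) (eval e u)
  | Imp p q => sat e p -> sat e q
  | All p => forall x : M, sat (scons x e) p
  end.

Definition model {L} (M : structure L) (S : theory L) : Prop :=
  forall p, S p -> forall e : nat -> M, sat e p.

Section Satisfaction.
Context {L : lang} {M : structure L}.
Implicit Types (e : nat -> M) (s : nat -> term L) (t u : term L) (p q : form L).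

Lemma eval_subst e s t : eval e (subst_term s t) = eval (fun n => eval e (s n)) t.
Proof. induction t; cbn; congruence. Qed.

Lemma eval_lift e t k : eval e (lift k t) = eval (fun n => e (n + k)) t.
Proof. apply eval_subst. Qed.

Lemma eval_lift1 e t x : eval (scons x e) (lift 1 t) = eval e t.
Proof.
  rewrite eval_lift; f_equal; extensionality n. now rewrite Nat.add_1_r.
Qed.

Lemma eval_lift2 e t x y : eval (scons x (scons y e)) (lift 2 t) = eval e t.
Proof.
  rewrite eval_lift; f_equal; extensionality n.
  now replace (n + 2) with (S (S n)) by lia.
Qed.

Lemma eval_lift3 e t x y z :
  eval (scons x (scons y (scons z e))) (lift 3 t) = eval e t.
Proof.
  rewrite eval_lift; f_equal; extensionality n.
  now replace (n + 3) with (S (S (S n))) by lia.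
Qed.

Lemma sat_subst e s p : sat e (subst s p) = sat (fun n => eval e (s n)) p.
Proof.
  revert e s; induction p; intros e s; cbn; rewrite ?eval_subst; auto.
  - now rewrite IHp1, IHp2.
  - apply propositional_extensionality.
    assert (E : forall x, (fun n => eval (scons x e) (up s n)) =
                          scons x (fun n => eval e (s n))).
    { intros x; extensionality n; destruct n; cbn; auto. apply eval_lift1. }
    split; intros H x; specialize (H x); rewrite IHp, E in *; auto.
Qed.

Lemma sat_inst1 e t p : sat e (inst [t] p) = sat (scons (eval e t) e) p.
Proof.
  rewrite inst1, sat_subst. f_equal; extensionality n; now destruct n.
Qed.

Lemma eval_below e e' t n :
  below_term n t -> (forall i, i < n -> e i = e' i) -> eval e t = eval e' t.
Proof. induction t; cbn; intros; auto. f_equal; auto. Qed.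

Lemma sat_below e e' p n :
  below n p -> (forall i, i < n -> e i = e' i) -> sat e p <-> sat e' p.
Proof.
  revert e e' n; induction p as [|t u|t u|r t u|p IHp q IHq|p IHp]; cbn;
    intros e e' n H E;
    try match type of H with _ /\ _ => destruct H as [H1 H2] end;
    rewrite ?(eval_below _ _ _ _ H1 E), ?(eval_below _ _ _ _ H2 E); try reflexivity.
  - now rewrite (IHp _ _ _ H1 E), (IHq _ _ _ H2 E).
  - assert (K : forall x, sat (scons x e) p <-> sat (scons x e') p).
    { intros x. apply IHp with (S n); auto. intros [|i] Hi; cbn; auto.
      apply E; lia. }
    split; intros G x; apply K, G.
Qed.

Lemma sat_Neg e p : sat e (Neg p) <-> ~ sat e p.
Proof. reflexivity. Qed.

Lemma sat_And e p q : sat e (And p q) <-> sat e p /\ sat e q.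
Proof. cbn; tauto. Qed.

Lemma sat_Or e p q : sat e (Or p q) <-> sat e p \/ sat e q.
Proof. cbn; tauto. Qed.

Lemma sat_Iff e p q : sat e (Iff p q) <-> (sat e p <-> sat e q).
Proof. cbn; tauto. Qed.

Lemma sat_Imp e p q : sat e (Imp p q) <-> (sat e p -> sat e q).
Proof. reflexivity. Qed.

Lemma sat_All e p : sat e (All p) <-> forall x, sat (scons x e) p.
Proof. reflexivity. Qed.

Lemma sat_Ex e p : sat e (Ex p) <-> exists x, sat (scons x e) p.
Proof.
  cbn. split; [|firstorder].
  intros H; apply NNPP; intros N; apply H; intros x Hx; eauto.
Qed.

Lemma sat_iter_All n p :
  (forall e, sat e p) -> forall e, sat e (Nat.iter n (@All L) p).
Proof.
  intros H; induction n as [|n IH]; cbn; auto.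
Qed.

Lemma sat_of_iter_All n p :
  (forall e, sat e (Nat.iter n (@All L) p)) -> forall e, sat e p.
Proof.
  induction n as [|n IH]; cbn; auto. intros H; apply IH.
  intros e. rewrite <- (scons_eta _ e). apply H.
Qed.

Lemma sat_closure p c :
  closure_of p c -> (forall e, sat e p) <-> (forall e, sat e c).
Proof.
  intros (n & _ & ->). split; [apply sat_iter_All|apply sat_of_iter_All].
Qed.

End Satisfaction.

Theorem soundness {L} (M : structure L) A (p : form L) :
  deriv A p -> forall e : nat -> M, (forall q, In q A -> sat e q) -> sat e p.
Proof.
  induction 1 as [A p I|A p q _ IH|A p q _ IH1 _ IH2|A p _ IH|A p _ IH|A p t _ IH
                 |A t|A p t u _ IH1 _ IH2]; intros e HA.
  - auto.
  - intros Hp. apply IH. intros r [<-|Hr]; auto.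
  - apply (IH1 e HA), IH2, HA.
  - apply NNPP, (IH e HA).
  - intros x. apply IH. intros q Hq. apply in_map_iff in Hq as (r & <- & Hr).
    rewrite sat_subst. now apply HA.
  - rewrite sat_inst1. apply (IH e HA).
  - reflexivity.
  - specialize (IH1 e HA); specialize (IH2 e HA). rewrite sat_inst1 in *.
    cbn in IH1. now rewrite <- IH1.
Qed.

Corollary model_consistent {L} (M : structure L) (S : theory L) (x : M) :
  model M S -> consistent S.
Proof.
  intros HM (A & HA & D). apply (soundness M _ _ D (fun _ => x)).
  intros q Hq. apply HM, HA, Hq.
Qed.
(** * Completeness for countable languages *)

Section Completeness.
Context {L : lang} (code_fsym : fsym L -> nat) (code_rsym : rsym L -> nat).
Hypothesis code_fsym_inj : forall a b, code_fsym a = code_fsym b -> a = b.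
Hypothesis code_rsym_inj : forall a b, code_rsym a = code_rsym b -> a = b.
Implicit Types (t u : term L) (p q : form L) (S Ω : theory L).

Local Notation pr x y := (Cantor.to_nat (x, y)).

Lemma pr_inj x y x' y' : pr x y = pr x' y' -> x = x' /\ y = y'.
Proof. intros H%Cantor.to_nat_inj. now inversion H. Qed.

Lemma pr_ge x y : x <= pr x y /\ y <= pr x y.
Proof. pose proof (Cantor.to_nat_non_decreasing x y); lia. Qed.

Opaque Cantor.to_nat.

Fixpoint code_term t : nat :=
  match t with
  | Var n => pr 0 (1 + n)
  | App g u => pr (1 + code_fsym g) (code_term u)
  end.

Fixpoint code p : nat :=
  match p with
  | Bot => pr 0 0
  | Eq t u => pr 1 (pr (code_term t) (code_term u))
  | Mem t u => pr 2 (pr (code_term t) (code_term u))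
  | Rel r t u => pr 3 (pr (code_rsym r) (pr (code_term t) (code_term u)))
  | Imp p q => pr 4 (pr (code p) (code q))
  | All p => pr 5 (code p)
  end.

Lemma code_term_inj t u : code_term t = code_term u -> t = u.
Proof.
  revert u; induction t; intros []; cbn -[Nat.add]; intros [H1 H2]%pr_inj; try lia.
  - f_equal; lia.
  - f_equal; [apply code_fsym_inj; lia|auto].
Qed.

Lemma code_inj p q : code p = code q -> p = q.
Proof.
  revert q; induction p; intros []; cbn -[Nat.add]; intros [H1 H2]%pr_inj; try lia; auto;
    f_equal; auto;
    repeat match goal with H : pr _ _ = pr _ _ |- _ => apply pr_inj in H as [] end;
    auto using code_term_inj.
Qed.

(** Pairing is monotone, so a code exceeds every variable of the formula. *)
Lemma below_code_term t : below_term (code_term t) t.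
Proof.
  induction t as [n|g u IH]; cbn.
  - destruct (pr_ge 0 (Datatypes.S n)); lia.
  - eapply below_term_mono; [exact IH|]. apply pr_ge.
Qed.

Lemma below_code p : below (code p) p.
Proof.
  assert (T2 : forall n t u, below_term (pr n (pr (code_term t) (code_term u))) t
                          /\ below_term (pr n (pr (code_term t) (code_term u))) u).
  { intros n t u. pose proof (pr_ge n (pr (code_term t) (code_term u))).
    pose proof (pr_ge (code_term t) (code_term u)).
    split; eapply below_term_mono; try apply below_code_term; lia. }
  induction p as [|t u|t u|r t u|p IHp q IHq|p IHp]; cbn; auto.
  - destruct (T2 (code_rsym r) t u).
    split; eapply below_term_mono; eauto; apply pr_ge.
  - pose proof (pr_ge 4 (pr (code p) (code q))). pose proof (pr_ge (code p) (code q)).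
    split; eapply below_mono; eauto; lia.
  - pose proof (pr_ge 5 (code p)). eapply below_mono; eauto; lia.
Qed.

(** ** Lindenbaum extensions *)

Fixpoint lindenbaum_stage S n : theory L :=
  match n with
  | 0 => S
  | Datatypes.S n => fun p => lindenbaum_stage S n p \/
      (code p = n /\ consistent (add (lindenbaum_stage S n) p))
  end.

Definition maximal Ω := forall p, consistent (add Ω p) -> Ω p.

Lemma lindenbaum_stage_mono S n m p :
  n <= m -> lindenbaum_stage S n p -> lindenbaum_stage S m p.
Proof. induction 1; cbn; auto. Qed.

Lemma lindenbaum_stage_consistent S n :
  consistent S -> consistent (lindenbaum_stage S n).
Proof.
  intros HS; induction n as [|n IH]; auto. cbn.
  destruct (classic (exists p, code p = n /\ consistent (add (lindenbaum_stage S n) p)))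
    as [(p & <- & Hp)|N]; intros C.
  - apply Hp. revert C. apply proves_mono. intros q [Hq|[Hq _]]; [now left|right].
    now apply code_inj.
  - apply IH. revert C. apply proves_mono. intros q [Hq|Hq]; auto.
    exfalso; apply N; eauto.
Qed.

Lemma chain_consistent (Γ : nat -> theory L) :
  (forall n m p, n <= m -> Γ n p -> Γ m p) -> (forall n, consistent (Γ n)) ->
  consistent (fun p => exists n, Γ n p).
Proof.
  intros Hmono Hcons (A & HA & D).
  assert (HN : exists n, forall q, In q A -> Γ n q).
  { clear D; induction A as [|a A IH].
    - exists 0; intros q [].
    - destruct (IH (fun q Hq => HA q (or_intror Hq))) as (n & Hn).
      destruct (HA a (or_introl eq_refl)) as (m & Hm).
      exists (n + m). intros q [<-|Hq].
      + apply Hmono with m; auto; lia.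
      + apply Hmono with n; auto; lia. }
  destruct HN as (n & Hn). apply (Hcons n). now exists A.
Qed.

Lemma lindenbaum S : consistent S ->
  exists Ω, (forall p, S p -> Ω p) /\ consistent Ω /\ maximal Ω.
Proof.
  intros HS. exists (fun p => exists n, lindenbaum_stage S n p). split; [|split].
  - intros p Hp. now exists 0.
  - apply chain_consistent.
    + intros n m p. apply lindenbaum_stage_mono.
    + intros n. now apply lindenbaum_stage_consistent.
  - intros p Hp. exists (Datatypes.S (code p)). right; split; auto. intros C. apply Hp.
    revert C. apply proves_mono. intros q [Hq|Hq]; [left; eauto|now right].
Qed.

(** ** Henkin axioms *)

Definition henkin_axiom k p : form L := Imp (inst [Var k] p) (All p).

(** The witness for [p] is the variable [B + code p]: it occurs neither in [p],
    nor in the formulas below [B], nor in the axiom of any formula of smaller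
    code.  Hence the axioms can be removed one by one, largest code first. *)
Definition henkin_stage B S n : theory L := fun p =>
  S p \/ exists q, code q < n /\ p = henkin_axiom (B + code q) q.

Lemma henkin_stage_below B S n p :
  (forall q, S q -> below B q) -> henkin_stage B S n p -> below (B + n) p.
Proof.
  intros HS [H|(q & Hq & ->)].
  - apply below_mono with B; auto; lia.
  - split.
    + rewrite inst1. apply below_subst with (code q); [apply below_code|].
      intros [|i] Hi; cbn; lia.
    + cbn. apply below_mono with (code q); [apply below_code|lia].
Qed.

Lemma henkin_stage_consistent B S n :
  (forall q, S q -> below B q) -> consistent S -> consistent (henkin_stage B S n).
Proof.
  intros HB HS; induction n as [|n IH]; intros C.
  - apply HS. revert C. apply proves_mono. intros q [Hq|(r & Hr & _)]; auto; lia.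
  - destruct (classic (exists q, code q = n)) as [(q & Hq)|N].
    + assert (D : proves (henkin_stage B S n) (Neg (henkin_axiom (B + n) q))).
      { apply proves_deduction. revert C. apply proves_mono.
        intros p [Hp|(r & Hr & ->)]; [left; now left|].
        destruct (Nat.eq_dec (code r) n) as [E|E].
        - right. rewrite E. rewrite <- Hq in E. now rewrite (code_inj _ _ E).
        - left; right. exists r; split; auto; lia. }
      apply proves_neg_imp in D as [(A & HA & D1) D2].
      apply IH. apply proves_mp with (All q); [exact D2|].
      exists A; split; auto. apply deriv_generalize with (B + n); auto.
      * intros r Hr. eapply henkin_stage_below; eauto.
      * apply below_mono with (code q); [apply below_code|lia].
    + apply IH. revert C. apply proves_mono.
      intros p [Hp|(r & Hr & ->)]; [now left|right]. exists r; split; auto.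
      destruct (Nat.eq_dec (code r) n); [exfalso; eauto|lia].
Qed.

Lemma henkin_extension B S :
  (forall q, S q -> below B q) -> consistent S ->
  exists Ω, (forall p, S p -> Ω p) /\ consistent Ω /\ maximal Ω /\
    forall p, exists t, Ω (Imp (inst [t] p) (All p)).
Proof.
  intros HB HS.
  destruct (lindenbaum (fun p => exists n, henkin_stage B S n p)) as (Ω & H1 & H2 & H3).
  - apply chain_consistent; [|intros n; now apply henkin_stage_consistent].
    intros n m p Hnm [H|(q & Hq & E)]; [now left|right]. exists q; split; auto; lia.
  - exists Ω; repeat split; auto.
    + intros p Hp. apply H1. exists 0; now left.
    + intros p. exists (Var (B + code p)). apply H1.
      exists (1 + code p). right. exists p; split; auto.
Qed.

(** ** The term model *)

Section TermModel.
Variable Ω : theory L.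
Hypothesis Ω_consistent : consistent Ω.
Hypothesis Ω_maximal : maximal Ω.
Hypothesis Ω_henkin : forall p, exists t, Ω (Imp (inst [t] p) (All p)).

Lemma Ω_closed p : proves Ω p -> Ω p.
Proof.
  intros H. apply Ω_maximal. intros C. apply Ω_consistent.
  apply proves_mp with p; auto. now apply proves_deduction.
Qed.

Lemma Ω_imp p q : Ω (Imp p q) <-> (Ω p -> Ω q).
Proof.
  split.
  - intros H Hp. apply Ω_closed. apply proves_mp with p; now apply proves_ax.
  - intros H. apply Ω_closed. apply proves_deduction.
    destruct (classic (Ω p)) as [Hp|Hp].
    + apply proves_ax. left; auto.
    + apply proves_absurd. apply NNPP; intros C. apply Hp, Ω_maximal, C.
Qed.

Lemma Ω_all p : Ω (All p) <-> forall t, Ω (inst [t] p).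
Proof.
  split.
  - intros H t. apply Ω_closed. generalize (proves_ax _ _ H).
    apply proves_deriv1. intros A. apply D_allE.
  - intros H. destruct (Ω_henkin p) as (t & Ht). rewrite Ω_imp in Ht. auto.
Qed.

Definition equiv t u := Ω (Eq t u).

Lemma equiv_refl t : equiv t t.
Proof. apply Ω_closed. exists []; split; [intros _ []|apply D_refl]. Qed.

Lemma equiv_leib t u p : equiv t u -> Ω (inst [t] p) -> Ω (inst [u] p).
Proof.
  intros H H'. apply Ω_closed. generalize (proves_ax _ _ H) (proves_ax _ _ H').
  apply proves_deriv2. intros A. apply D_leib.
Qed.

Lemma inst_lift t u : subst_term (fun n => nth n [t] (Var (n - 1))) (lift 1 u) = u.
Proof.
  rewrite subst_lift. rewrite <- (subst_term_var u) at 2. f_equal; extensionality n.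
  cbn. rewrite Nat.sub_0_r. now destruct n.
Qed.

Lemma equiv_sym t u : equiv t u -> equiv u t.
Proof.
  intros H. pose proof (equiv_leib t u (Eq (Var 0) (lift 1 t)) H) as K.
  unfold inst in K; cbn -[nth] in K. rewrite !inst_lift in K. apply K, equiv_refl.
Qed.

Lemma equiv_trans t u v : equiv t u -> equiv u v -> equiv t v.
Proof.
  intros H H'. pose proof (equiv_leib u v (Eq (lift 1 t) (Var 0)) H') as K.
  unfold inst in K; cbn -[nth] in K. rewrite !inst_lift in K. now apply K.
Qed.

Lemma equiv_app g t u : equiv t u -> equiv (App g t) (App g u).
Proof.
  intros H. pose proof (equiv_leib t u (Eq (lift 1 (App g t)) (App g (Var 0))) H) as K.
  unfold inst in K; cbn -[nth lift] in K. rewrite !inst_lift in K. apply K, equiv_refl.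
Qed.

(** One representative per class turns provable equality into identity. *)
Definition rep t : term L := epsilon (inhabits (Var 0)) (equiv t).

Lemma equiv_rep t : equiv t (rep t).
Proof. apply (epsilon_spec (inhabits (Var 0)) (equiv t)). exists t. apply equiv_refl. Qed.

Lemma rep_equiv t u : rep t = rep u <-> equiv t u.
Proof.
  split; intros H.
  - apply equiv_trans with (rep t); [apply equiv_rep|]. rewrite H.
    apply equiv_sym, equiv_rep.
  - unfold rep. f_equal. extensionality v. apply propositional_extensionality.
    split; eauto using equiv_trans, equiv_sym.
Qed.

Definition class := { t | rep t = t }.

Definition class_of t : class.
Proof. exists (rep t). apply rep_equiv, equiv_sym, equiv_rep. Defined.

Lemma class_of_eq t u : class_of t = class_of u <-> equiv t u.
Proof.
  rewrite <- rep_equiv. split; intros H.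
  - now apply (f_equal (@proj1_sig _ _)) in H.
  - now apply subset_eq_compat.
Qed.

Lemma class_of_proj (x : class) : class_of (proj1_sig x) = x.
Proof. destruct x as [t Ht]. now apply subset_eq_compat. Qed.

Definition term_model : structure L := {|
  dom := class;
  fun_of g x := class_of (App g (proj1_sig x));
  rel_of r x y := Ω (Rel r (proj1_sig x) (proj1_sig y));
  mem_of x y := Ω (Mem (proj1_sig x) (proj1_sig y)) |}.

Lemma Ω_rel_rep r t u : Ω (Rel r (rep t) (rep u)) <-> Ω (Rel r t u).
Proof.
  assert (H : forall t u t' u', equiv t t' -> equiv u u' -> Ω (Rel r t u) -> Ω (Rel r t' u')).
  { intros t1 u1 t2 u2 E F K.
    pose proof (equiv_leib t1 t2 (Rel r (Var 0) (lift 1 u1)) E) as K1.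
    pose proof (equiv_leib u1 u2 (Rel r (lift 1 t2) (Var 0)) F) as K2.
    unfold inst in K1, K2; cbn -[nth] in K1, K2. rewrite !inst_lift in K1, K2. auto. }
  split; apply H; auto using equiv_sym, equiv_rep.
Qed.

Lemma Ω_mem_rep t u : Ω (Mem (rep t) (rep u)) <-> Ω (Mem t u).
Proof.
  assert (H : forall t u t' u', equiv t t' -> equiv u u' -> Ω (Mem t u) -> Ω (Mem t' u')).
  { intros t1 u1 t2 u2 E F K.
    pose proof (equiv_leib t1 t2 (Mem (Var 0) (lift 1 u1)) E) as K1.
    pose proof (equiv_leib u1 u2 (Mem (lift 1 t2) (Var 0)) F) as K2.
    unfold inst in K1, K2; cbn -[nth] in K1, K2. rewrite !inst_lift in K1, K2. auto. }
  split; apply H; auto using equiv_sym, equiv_rep.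
Qed.

Lemma eval_term_model (s : nat -> term L) t :
  eval (M := term_model) (fun n => class_of (s n)) t = class_of (subst_term s t).
Proof.
  induction t as [n|g t IH]; cbn; auto. rewrite IH.
  apply class_of_eq, equiv_app, equiv_sym, equiv_rep.
Qed.

Lemma sat_term_model p (s : nat -> term L) :
  sat (M := term_model) (fun n => class_of (s n)) p <-> Ω (subst s p).
Proof.
  revert s; induction p as [|t u|t u|r t u|p IHp q IHq|p IHp]; intros s; cbn;
    rewrite ?eval_term_model.
  - split; [intros []|]. intros H. apply Ω_consistent. now apply proves_ax.
  - apply class_of_eq.
  - apply Ω_mem_rep.
  - apply Ω_rel_rep.
  - rewrite Ω_imp, IHp, IHq. reflexivity.
  - assert (E : forall t, scons (class_of t) (fun n => class_of (s n)) =
                          (fun n => class_of (scons t s n))).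
    { intros t; extensionality n; now destruct n. }
    rewrite Ω_all. split.
    + intros H t. rewrite inst_up. apply IHp. rewrite <- E. apply H.
    + intros H x. rewrite <- (class_of_proj x), E. apply IHp.
      rewrite <- inst_up. apply H.
Qed.

End TermModel.

Theorem model_existence B S :
  (forall q, S q -> below B q) -> consistent S ->
  exists (M : structure L) (e : nat -> M), forall p, S p -> sat e p.
Proof.
  intros HB HS.
  destruct (henkin_extension B S HB HS) as (Ω & H1 & H2 & H3 & H4).
  exists (term_model Ω H2 H3), (fun n => class_of Ω H2 H3 (Var n)).
  intros p Hp. apply sat_term_model; auto. rewrite subst_var; auto.
Qed.

Theorem completeness S p :
  (forall q, S q -> below 0 q) ->
  (forall M : structure L, model M S -> forall e : nat -> M, sat e p) ->
  proves S p.
Proof.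
  intros HS H. apply NNPP; intros N. apply consistent_add_neg in N.
  destruct (model_existence (code p) (add S (Neg p))) as (M & e & He); auto.
  - intros q [Hq| ->].
    + apply below_mono with 0; auto; lia.
    + split; [apply below_code|exact I].
  - apply (He (Neg p)); [now right|]. apply H. intros q Hq e'.
    apply (sat_below e e' q 0); auto; [intros; lia|]. apply He. now left.
Qed.

End Completeness.

(** * Definability with parameters *)

Definition set_structure (D : Type) (mem : D -> D -> Prop) : structure Lset := {|
  dom := D;
  fun_of (g : fsym Lset) := match (g : Empty_set) with end;
  rel_of (r : rsym Lset) := match (r : Empty_set) with end;
  mem_of := mem |}.

Definition zip {X : Type} (a b : nat -> X) (n : nat) : X :=
  if Nat.even n then a (Nat.div2 n) else b (Nat.div2 n).

Lemma zip_even (X : Type) (a b : nat -> X) n : zip a b (2 * n) = a n.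
Proof. unfold zip. now rewrite Nat.even_even, Nat.div2_double. Qed.

Lemma zip_odd (X : Type) (a b : nat -> X) n : zip a b (S (2 * n)) = b n.
Proof. unfold zip. now rewrite Nat.even_succ, Nat.odd_even, Nat.div2_succ_double. Qed.

Lemma zip_unique (X : Type) (a b s : nat -> X) :
  (forall n, s (2 * n) = a n) -> (forall n, s (S (2 * n)) = b n) -> s = zip a b.
Proof.
  intros H K; extensionality n.
  destruct (Nat.Even_or_Odd n) as [[m ->]|[m ->]].
  - now rewrite zip_even.
  - rewrite Nat.add_1_r. now rewrite zip_odd.
Qed.

Lemma sat_zip (M : structure Lset) (e c : nat -> M) (a b : nat -> term Lset) (d : nat -> M) p :
  (forall n, eval d (a n) = e n) -> (forall n, eval d (b n) = c n) ->
  sat d (subst (zip a b) p) = sat (zip e c) p.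
Proof.
  intros H K. rewrite sat_subst. f_equal. apply zip_unique; intros n.
  - now rewrite zip_even.
  - now rewrite zip_odd.
Qed.

Section Definability.
Context {D : Type} (mem : D -> D -> Prop).

Notation "x ∊ y" := (mem x y) (at level 70).

(** Arguments occupy the even positions and parameters the odd ones, so that
    there is room for infinitely many of both and no arity to keep track of. *)
Definition definable (R : (nat -> D) -> Prop) : Prop :=
  exists (p : form Lset) (c : nat -> D),
    forall e, R e <-> sat (M := set_structure D mem) (zip e c) p.

Lemma definable_ext R R' : definable R -> (forall e, R e <-> R' e) -> definable R'.
Proof. intros (p & c & H) E. exists p, c. intros e. now rewrite <- E. Qed.

(** Argument [i] is replaced by a variable ([inl]) or by a parameter ([inr]). *)
Definition reindex (t : nat -> nat + D) (e : nat -> D) (i : nat) : D :=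
  match t i with inl k => e k | inr d => d end.

Lemma definable_reindex R t : definable R -> definable (fun e => R (reindex t e)).
Proof.
  intros (p & c & H).
  exists (subst (zip (fun i => match t i with
                               | inl k => Var (2 * k) | inr _ => Var (S (2 * (2 * i))) end)
                     (fun i => Var (S (2 * S (2 * i))))) p).
  exists (zip (fun i => match t i with inl _ => c i | inr d => d end) c).
  intros e. rewrite H. symmetry.
  erewrite sat_zip; [reflexivity| |]; intros i; unfold reindex.
  - destruct (t i) eqn:E; cbn -[Nat.mul].
    + now rewrite zip_even.
    + now rewrite zip_odd, zip_even, E.
  - cbn -[Nat.mul]. now rewrite !zip_odd.
Qed.

Lemma definable_imp R R' :
  definable R -> definable R' -> definable (fun e => R e -> R' e).
Proof.
  intros (p & c & H) (q & d & K).
  exists (Imp (subst (zip (fun i => Var (2 * i)) (fun i => Var (S (2 * (2 * i))))) p)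
              (subst (zip (fun i => Var (2 * i)) (fun i => Var (S (2 * S (2 * i))))) q)).
  exists (zip c d). intros e. rewrite H, K. cbn [sat].
  rewrite (sat_zip (set_structure D mem) e c), (sat_zip (set_structure D mem) e d);
    [reflexivity|..]; intros i; cbn -[Nat.mul]; now rewrite ?zip_odd, ?zip_even.
Qed.

Lemma definable_all (R : D -> (nat -> D) -> Prop) :
  definable (fun e => R (e 0) (fun n => e (S n))) ->
  definable (fun e => forall x, R x e).
Proof.
  intros (p & c & H).
  exists (All (subst (zip (scons (Var 0) (fun i => Var (S (2 * i))))
                          (fun i => Var (S (S (2 * i))))) p)), c.
  intros e. cbn [sat].
  assert (K : forall x, R x e <-> sat (M := set_structure D mem) (zip (scons x e) c) p).
  { intros x. now rewrite <- H. }
  assert (G : forall x, sat (M := set_structure D mem) (scons x (zip e c))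
      (subst (zip (scons (Var 0) (fun i => Var (S (2 * i)))) (fun i => Var (S (S (2 * i))))) p)
      = sat (M := set_structure D mem) (zip (scons x e) c) p).
  { intros x. apply sat_zip.
    - intros [|i]; cbn -[Nat.mul]; auto. now rewrite zip_even.
    - intros i. cbn -[Nat.mul]. now rewrite zip_odd. }
  split; intros F x; specialize (F x); rewrite ?G, ?K in *; auto.
Qed.

Lemma definable_not R : definable R -> definable (fun e => ~ R e).
Proof.
  intros (p & c & H). exists (Neg p), c. intros e. now rewrite H.
Qed.

Lemma definable_ex (R : D -> (nat -> D) -> Prop) :
  definable (fun e => R (e 0) (fun n => e (S n))) ->
  definable (fun e => exists x, R x e).
Proof.
  intros H. eapply definable_ext.
  - apply definable_not, (definable_all (fun x e => ~ R x e)).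
    apply (definable_not _ H).
  - intros e; split; [|firstorder].
    intros N. apply NNPP. intros G. apply N. intros x Hx. eauto.
Qed.

Lemma definable_and R R' : definable R -> definable R' -> definable (fun e => R e /\ R' e).
Proof.
  intros H H'. eapply definable_ext.
  - apply definable_not, (definable_imp R (fun e => ~ R' e)); [exact H|apply definable_not, H'].
  - intros e; cbn; tauto.
Qed.

Lemma definable_or R R' : definable R -> definable R' -> definable (fun e => R e \/ R' e).
Proof.
  intros H H'. eapply definable_ext.
  - apply (definable_imp (fun e => ~ R e)); [apply definable_not, H|apply H'].
  - intros e; cbn; tauto.
Qed.

Lemma definable_iff R R' : definable R -> definable R' -> definable (fun e => R e <-> R' e).
Proof. intros; apply definable_and; now apply definable_imp. Qed.

Definition simple (τ : (nat -> D) -> D) : Prop :=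
  (exists i, forall e, τ e = e i) \/ (exists d, forall e, τ e = d).

Lemma simple_var i : simple (fun e => e i).
Proof. left; now exists i. Qed.

Lemma simple_const d : simple (fun _ => d).
Proof. right; now exists d. Qed.

Lemma simple_reindex τ : simple τ -> exists s : nat + D, forall e,
  τ e = match s with inl k => e k | inr d => d end.
Proof. intros [(i & H)|(d & H)]; [exists (inl i)|exists (inr d)]; auto. Qed.

Lemma definable_rel1 (P : D -> Prop) τ :
  definable (fun e => P (e 0)) -> simple τ -> definable (fun e => P (τ e)).
Proof.
  intros H (s & Hs)%simple_reindex.
  eapply definable_ext; [apply (definable_reindex _ (fun _ => s) H)|].
  intros e; cbn. now rewrite Hs.
Qed.

Lemma definable_rel2 (R : D -> D -> Prop) τ σ :
  definable (fun e => R (e 0) (e 1)) -> simple τ -> simple σ ->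
  definable (fun e => R (τ e) (σ e)).
Proof.
  intros H (s & Hs)%simple_reindex (t & Ht)%simple_reindex.
  eapply definable_ext; [apply (definable_reindex _ (scons s (fun _ => t)) H)|].
  intros e; unfold reindex; cbn. now rewrite Hs, Ht.
Qed.

Hypothesis D_inhabited : inhabited D.

Lemma definable_mem τ σ : simple τ -> simple σ -> definable (fun e => τ e ∊ σ e).
Proof.
  apply (definable_rel2 mem). destruct D_inhabited as [d].
  exists (Mem (Var 0) (Var 2)), (fun _ => d). reflexivity.
Qed.

Lemma definable_eq τ σ : simple τ -> simple σ -> definable (fun e => τ e = σ e).
Proof.
  apply (definable_rel2 eq). destruct D_inhabited as [d].
  exists (Eq (Var 0) (Var 2)), (fun _ => d). reflexivity.
Qed.

End Definability.

(** Splits a definability goal along its connectives; definable relations may be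
    supplied as hypotheses. *)
Ltac definable_step :=
  cbn beta;
  match goal with
  | |- simple _ => first [apply simple_var | apply simple_const]
  | |- definable _ (fun e => _ <-> _) => apply definable_iff
  | |- definable _ (fun e => ~ _) => apply definable_not
  | |- definable _ (fun e => _ -> _) => apply definable_imp
  | |- definable _ (fun e => _ /\ _) => apply definable_and
  | |- definable _ (fun e => _ \/ _) => apply definable_or
  | |- definable _ (fun e => forall x, @?R x e) => apply definable_all
  | |- definable _ (fun e => exists x, @?R e x) =>
      apply (definable_ex _ (fun x e => R e x))
  | |- definable _ (fun e => _ = _) => apply definable_eq; [assumption| |]
  | |- definable ?m (fun e => ?m _ _) => apply definable_mem; [assumption| |]
  | H : definable _ (fun e => ?R (e 0) (e 1)) |- definable _ (fun e => ?R _ _) =>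
      apply (definable_rel2 _ R); [exact H| |]
  | H : definable _ (fun e => ?P (e 0)) |- definable _ (fun e => ?P _) =>
      apply (definable_rel1 _ P); [exact H|]
  end.
Ltac definability := repeat definable_step.


(** * Set-theoretic notions in a structure *)

Section Notions.
Context {D : Type} (mem : D -> D -> Prop).

Notation "x ∊ y" := (mem x y) (at level 70).

Definition Subset (a b : D) := forall x, x ∊ a -> x ∊ b.
Definition Pair (c a b : D) := forall x, x ∊ c <-> x = a \/ x = b.
Definition OPair (c a b : D) := forall x, x ∊ c <-> Pair x a a \/ Pair x a b.
Definition Graph (g a b : D) := exists q, q ∊ g /\ OPair q a b.
Definition Succ (s a : D) := forall x, x ∊ s <-> x ∊ a \/ x = a.
Definition Transitive (a : D) := forall x, x ∊ a -> Subset x a.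
Definition Ordinal (a : D) := Transitive a /\ forall x, x ∊ a -> Transitive x.
Definition Limit (a : D) :=
  Ordinal a /\ ~ (forall x, ~ x ∊ a) /\ forall x, x ∊ a -> exists y, y ∊ a /\ Succ y x.
Definition Stage (g c w : D) :=
  forall x, x ∊ w <-> exists d, d ∊ c /\ exists u, Graph g d u /\ Subset x u.
Definition Stages (g b : D) :=
  forall c, c ∊ b \/ c = b ->
    exists w, (forall u, Graph g c u <-> u = w) /\ Stage g c w.
Definition IsV (b v : D) := exists g, Stages g b /\ Graph g b v.

(** [U = V_a], [w = V_(j(a)+1)]; [F] is the graph of [f] and [J] is [j]. *)
Definition MovementWitness (F : D -> D -> Prop) (J : D -> D) (a : D) :=
  Limit a /\ exists U s w,
    IsV a U /\ Succ s (J a) /\ IsV s w /\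
    (Subset w U /\ w <> U) /\
    ((forall x, x ∊ U -> exists y, F x y) /\
     (forall y, y ∊ w <-> exists x, x ∊ U /\ F x y)) /\
    (forall a, Subset a U -> exists b, forall y, y ∊ b <-> exists x, x ∊ a /\ F x y) /\
    (forall a, (forall c, c ∊ a -> exists x, x ∊ w /\ exists y, y ∊ w /\ Pair c x y) ->
      exists b, forall c, c ∊ b <->
        exists z u p q r, Pair c z u /\ F z p /\ F u q /\ Pair r p q /\ r ∊ a).

End Notions.

Lemma all_iff (A : Type) (P Q : A -> Prop) :
  (forall x, P x <-> Q x) -> (forall x, P x) <-> (forall x, Q x).
Proof. firstorder. Qed.

Lemma ex_iff (A : Type) (P Q : A -> Prop) :
  (forall x, P x <-> Q x) -> (exists x, P x) <-> (exists x, Q x).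
Proof. firstorder. Qed.

Lemma and_compat (A B C D : Prop) : (A <-> B) -> (C <-> D) -> (A /\ C) <-> (B /\ D).
Proof. tauto. Qed.

Lemma or_compat (A B C D : Prop) : (A <-> B) -> (C <-> D) -> (A \/ C) <-> (B \/ D).
Proof. tauto. Qed.

Lemma imp_compat (A B C D : Prop) : (A <-> B) -> (C <-> D) -> (A -> C) <-> (B -> D).
Proof. tauto. Qed.

Lemma iff_compat (A B C D : Prop) : (A <-> B) -> (C <-> D) -> (A <-> C) <-> (B <-> D).
Proof. tauto. Qed.

Ltac sat_step :=
  match goal with
  | |- sat _ (All _) <-> _ => rewrite sat_All; apply all_iff; intro
  | |- sat _ (Ex _) <-> _ => rewrite sat_Ex; apply ex_iff; intro
  | |- sat _ (And _ _) <-> _ => rewrite sat_And; apply and_compat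
  | |- sat _ (Or _ _) <-> _ => rewrite sat_Or; apply or_compat
  | |- sat _ (Iff _ _) <-> _ => rewrite sat_Iff; apply iff_compat
  | |- sat _ (Neg _) <-> _ => rewrite sat_Neg; apply not_iff_compat
  | |- sat _ (Imp _ _) <-> _ => rewrite sat_Imp; apply imp_compat
  end.

(** Proves [sat e p <-> P] when [P] has the same logical shape as [p]: after the
    common connectives are stripped, only liftings remain to be evaluated. *)
Ltac sat_unfold :=
  repeat sat_step; cbn -[lift]; rewrite ?eval_lift1, ?eval_lift2, ?eval_lift3;
  cbn -[lift]; rewrite ?eval_lift1, ?eval_lift2, ?eval_lift3; cbn -[lift]; reflexivity.

Ltac unfold_notions :=
  unfold is_limit, is_ordinal, transitive, is_V, is_stage, is_succ, graph, is_opair,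
    is_pair, is_empty, subset, AllIn, ExIn,
    Limit, Ordinal, Transitive, IsV, Stages, Stage, Succ, Graph, OPair, Pair, Subset.

Lemma sat_is_V {L} (M : structure L) (e : nat -> M) b v :
  sat e (is_V b v) <-> IsV mem_of (eval e b) (eval e v).
Proof. unfold_notions. sat_unfold. Qed.

Lemma sat_movement_witness (M : structure LT) (e : nat -> M) a :
  sat e (movement_witness a) <->
  MovementWitness mem_of (rel_of (s := M) f_sym) (fun_of (s := M) j_sym) (eval e a).
Proof.
  unfold movement_witness, MovementWitness, f_maps_onto, f_images, f_pair_preimages.
  unfold_notions. sat_unfold.
Qed.

(** * Working in a model of ZF *)

(** ZF as seen from inside the model: separation by every class definable with
    parameters, instead of by formulas. *)
Record set_theory {D : Type} (mem : D -> D -> Prop) : Prop := {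
  st_inhabited : inhabited D;
  st_ext : forall a b, (forall x, mem x a <-> mem x b) -> a = b;
  st_found : forall a, (exists x, mem x a) ->
    exists x, mem x a /\ forall y, mem y x -> ~ mem y a;
  st_pair : forall a b, exists c, Pair mem c a b;
  st_union : forall a, exists b, forall x, mem x b <-> exists y, mem y a /\ mem x y;
  st_power : forall a, exists b, forall x, mem x b <-> Subset mem x a;
  st_sep : forall P : D -> Prop, definable mem (fun e => P (e 0)) ->
    forall a, exists b, forall x, mem x b <-> mem x a /\ P x }.

Lemma ex_below {L} (p : form L) : exists n, below n p.
Proof.
  assert (HT : forall t : term L, exists n, below_term n t).
  { induction t as [n|]; cbn; eauto. }
  induction p as [|t u|t u|r t u|p [n IHp] q [m IHq]|p [n IHp]]; cbn.
  2-4: destruct (HT t) as [n Hn], (HT u) as [m Hm]; exists (n + m);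
    split; eapply below_term_mono; eauto; lia.
  - now exists 0.
  - exists (n + m). split; eapply below_mono; eauto; lia.
  - exists n. eapply below_mono; eauto; lia.
Qed.

Lemma set_theory_of_model {D : Type} (mem : D -> D -> Prop) :
  inhabited D -> model (set_structure D mem) ZF -> set_theory mem.
Proof.
  intros [d] HM. set (M := set_structure D mem) in *.
  set (e0 := fun _ : nat => d).
  split.
  - now exists.
  - assert (H : sat (M := M) e0 Extensionality) by apply HM, ZF_ext.
    enough (K : sat (M := M) e0 Extensionality <-> forall a b, (forall x, mem x a <-> mem x b) -> a = b)
      by now apply K.
    unfold Extensionality. sat_unfold.
  - assert (H : sat (M := M) e0 Foundation) by apply HM, ZF_found.
    enough (K : sat (M := M) e0 Foundation <-> forall a, (exists x, mem x a) ->
      exists x, mem x a /\ forall y, mem y x -> ~ mem y a) by now apply K.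
    unfold Foundation. unfold_notions. sat_unfold.
  - assert (H : sat (M := M) e0 Pairing) by apply HM, ZF_pair.
    enough (K : sat (M := M) e0 Pairing <-> forall a b, exists c, Pair mem c a b)
      by now apply K.
    unfold Pairing. unfold_notions. sat_unfold.
  - assert (H : sat (M := M) e0 Union) by apply HM, ZF_union.
    enough (K : sat (M := M) e0 Union <-> 
      forall a, exists b, forall x, mem x b <-> exists y, mem y a /\ mem x y) by now apply K.
    unfold Union. unfold_notions. sat_unfold.
  - assert (H : sat (M := M) e0 PowerSet) by apply HM, ZF_power.
    enough (K : sat (M := M) e0 PowerSet <-> 
      forall a, exists b, forall x, mem x b <-> Subset mem x a) by now apply K.
    unfold PowerSet. unfold_notions. sat_unfold.
  - intros P (p & c & Hp) a.
    (* In [p] the element is variable 0 and [c i] is variable 2i + 1; the other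
       even variables are irrelevant and receive [d]. *)
    destruct (ex_below (Separation p)) as [n Hn].
    assert (H : forall e : nat -> M, sat e (Separation p)).
    { refine (proj2 (sat_closure (M := M) _ _ (ex_intro _ n (conj Hn eq_refl))) _).
      intros e. apply HM. eapply ZF_sep. exists n; split; [exact Hn|reflexivity]. }
    specialize (H (fun i => zip e0 c (S i)) a).
    unfold Separation in H. rewrite sat_Ex in H. destruct H as [b H]. exists b.
    intros x. specialize (H x). rewrite sat_Iff, sat_And, sat_subst in H.
    rewrite (H : mem x b <-> _). apply and_compat; [reflexivity|].
    assert (E : P x <-> sat (M := M) (zip (scons x e0) c) p) by exact (Hp (scons x e0)).
    rewrite E.
    match goal with |- sat ?u _ <-> sat ?v _ => replace u with v; [reflexivity|] end.
    symmetry; apply zip_unique.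
    + intros [|i]; auto.
      replace (2 * S i) with (S (S (2 * i))) by lia. cbn -[Nat.mul zip e0].
      replace (2 * i + 3) with (S (S (S (2 * i)))) by lia.
            change (zip e0 c (S (S (2 * i))) = e0 i).
      replace (S (S (2 * i))) with (2 * S i) by lia. rewrite zip_even.
      reflexivity.
    + intros i. cbn -[Nat.mul]. rewrite <- (zip_odd _ e0 c i).
      now replace (2 * i + 3) with (S (S (S (2 * i)))) by lia.
Qed.

(** * Levels of the cumulative hierarchy *)

Section Levels.
Context {D : Type} (mem : D -> D -> Prop) (ST : set_theory mem).
Notation "x ∊ y" := (mem x y) (at level 70).
Notation definable := (definable mem).
Notation Subset := (Subset mem).
Notation Transitive := (Transitive mem).
Notation Graph := (Graph mem).
Notation Stages := (Stages mem).
Notation IsV := (IsV mem).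

Let D_inhabited : inhabited D := st_inhabited mem ST.

Lemma succ_exists a : exists s, Succ mem s a.
Proof.
  destruct (st_pair mem ST a a) as [p Hp], (st_pair mem ST a p) as [q Hq].
  destruct (st_union mem ST q) as [s Hs]. exists s. intros x. rewrite Hs. split.
  - intros (y & Hy & Hx). apply Hq in Hy as [->| ->]; auto. apply Hp in Hx; tauto.
  - intros [Hx| ->]; [exists a|exists p]; split; auto; [apply Hq|apply Hq|apply Hp]; auto.
Qed.

(** Otherwise Foundation gives a least [m] at which [g] and [g'] differ; but the
    value at [m] is determined by the values at the members of [m]. *)
Lemma Stages_agree g g' b c w w' :
  Transitive b -> Stages g b -> Stages g' b ->
  c ∊ b \/ c = b -> Graph g c w -> Graph g' c w' -> w = w'.
Proof.
  intros Tb Hg Hg' Hc Gw Gw'. apply NNPP; intros N.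
  destruct (succ_exists b) as [s Hs].
  destruct (st_sep mem ST (fun c => exists w w', Graph g c w /\ Graph g' c w' /\ w <> w'))
    with (a := s) as [bad Hbad].
  { unfold Graph, OPair, Pair. definability. }
  destruct (st_found mem ST bad) as (m & Hm & Hmin).
  { exists c. apply Hbad. split; [now apply Hs|eauto]. }
  apply Hbad in Hm as (Hms & u & u' & Gu & Gu' & Hu). apply Hs in Hms.
  destruct (Hg m Hms) as (v & Uv & Sv), (Hg' m Hms) as (v' & Uv' & Sv').
  apply Uv in Gu as ->. apply Uv' in Gu' as ->. apply Hu.
  assert (K : forall d, d ∊ m -> forall x, Graph g d x <-> Graph g' d x).
  { intros d Hd.
    assert (Hdb : d ∊ b \/ d = b).
    { left. destruct Hms as [Hmb| ->]; auto. now apply (Tb m). }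
    destruct (Hg d Hdb) as (y & Uy & _), (Hg' d Hdb) as (y' & Uy' & _).
    intros x. rewrite Uy, Uy'.
    assert (y = y') as ->; [|reflexivity].
    apply NNPP; intros Ny. apply (Hmin d Hd). apply Hbad. split; [now apply Hs|].
    exists y, y'. rewrite Uy, Uy'. auto. }
  apply (st_ext mem ST). intros x. rewrite (Sv x), (Sv' x).
  split; intros (d & Hd & x' & Gx & Hx); exists d; split; auto; exists x'; split; auto;
    now apply K.
Qed.

Lemma V_unique b v v' : Transitive b -> IsV b v -> IsV b v' -> v = v'.
Proof.
  intros Tb (g & Hg & Gv) (g' & Hg' & Gv').
  apply (Stages_agree g g' b b v v'); auto.
Qed.

(** Levels are cumulative, so only the last one contributes to the union that
    defines the level of a successor. *)
Lemma V_succ b s v w : Transitive b -> Succ mem s b -> IsV b v -> IsV s w ->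
  forall x, x ∊ w <-> Subset x v.
Proof.
  intros Tb Hs Hv (g & Hg & Gw) x.
  assert (Hgb : Stages g b).
  { intros c Hc. apply Hg. left. now apply Hs. }
  destruct (Hg s (or_intror eq_refl)) as (w' & Uw & Sw). apply Uw in Gw as <-.
  destruct (Hgb b (or_intror eq_refl)) as (v' & Uv & Sv).
  assert (v' = v) as ->.
  { apply V_unique with b; auto. exists g; split; auto. now apply Uv. }
  rewrite (Sw x). split.
  - intros (d & Hd & u & Gu & Hx). apply Hs in Hd as [Hd| ->].
    + destruct (Hgb d (or_introl Hd)) as (u' & Uu & Su). apply Uu in Gu as ->.
      intros z Hz. apply Hx, Su in Hz as (d' & Hd' & t & Gt & Ht).
      apply Sv. exists d'; split; [now apply (Tb d)|eauto].
    + apply Uv in Gu as ->. exact Hx.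
  - intros Hx. exists b; split; [apply Hs; auto|]. exists v; split; auto. now apply Uv.
Qed.

End Levels.

(** * Automorphisms *)

Definition automorphism {D : Type} (mem : D -> D -> Prop) (J : D -> D) : Prop :=
  (forall x y, J x = J y -> x = y) /\ (forall y, exists x, J x = y) /\
  (forall x y, mem x y <-> mem (J x) (J y)).

Lemma automorphism_sat {D : Type} (mem : D -> D -> Prop) J (p : form Lset) :
  automorphism mem J -> forall e,
  sat (M := set_structure D mem) e p <-> sat (M := set_structure D mem) (fun n => J (e n)) p.
Proof.
  intros (Ji & Js & Jm).
  assert (HT : forall e (t : term Lset), eval (M := set_structure D mem) (fun n => J (e n)) t
    = J (eval (M := set_structure D mem) e t)).
  { intros e [n|[]]; reflexivity. }
  induction p as [|t u|t u|[]|p IHp q IHq|p IHp]; intros e; cbn [sat].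
  - reflexivity.
  - rewrite !HT. split; [intros ->|intros H; apply Ji]; auto.
  - rewrite !HT. apply Jm.
  - now rewrite IHp, IHq.
  - assert (E : forall x, scons (J x) (fun n => J (e n)) = (fun n => J (scons x e n))).
    { intros x; extensionality n; now destruct n. }
    split.
    + intros H y. destruct (Js y) as [x <-]. rewrite E. apply (proj1 (IHp _)), H.
    + intros H x. apply IHp. rewrite <- E. apply H.
Qed.

Lemma automorphism_IsV {D : Type} (mem : D -> D -> Prop) J b v :
  automorphism mem J -> IsV mem b v -> IsV mem (J b) (J v).
Proof.
  intros HJ H. set (M := set_structure D mem).
  apply (proj1 (sat_is_V M (fun n => J (scons b (fun _ => v) n)) (Var 0) (Var 1))).
  apply (proj1 (automorphism_sat mem J _ HJ _)).
  exact (proj2 (sat_is_V M (scons b (fun _ => v)) (Var 0) (Var 1)) H).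
Qed.

Lemma automorphism_Transitive {D : Type} (mem : D -> D -> Prop) J b :
  automorphism mem J -> Transitive mem b -> Transitive mem (J b).
Proof.
  intros (_ & Js & Jm) H x Hx y Hy.
  destruct (Js x) as [x' <-], (Js y) as [y' <-].
  apply (proj1 (Jm _ _)). apply (proj2 (Jm _ _)) in Hx, Hy. now apply (H x').
Qed.

(** * NF from an amenable external bijection between a set and its power set *)

Section PowerBijection.
Context {D : Type} (mem : D -> D -> Prop) (ST : set_theory mem).
Notation "x ∊ y" := (mem x y) (at level 70).
Notation definable := (definable mem).
Notation Subset := (Subset mem).
Notation Pair := (Pair mem).

Context (U : D) (h : D -> D).
Hypothesis h_sub : forall x, x ∊ U -> Subset (h x) U.
Hypothesis h_inj : forall x y, x ∊ U -> y ∊ U -> h x = h y -> x = y.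
Hypothesis h_surj : forall w, Subset w U -> exists x, x ∊ U /\ h x = w.
(** Amenability of [h]: it may be applied to sets elementwise, and inverted on
    sets of unordered pairs. *)
Hypothesis h_image : forall a, Subset a U ->
  exists b, forall w, w ∊ b <-> exists x, x ∊ a /\ w = h x.
Hypothesis h_pairs : forall a,
  (forall c, c ∊ a -> exists A, Subset A U /\ exists B, Subset B U /\ Pair c A B) ->
  exists b, forall c, c ∊ b <->
    exists z u r, z ∊ U /\ u ∊ U /\ Pair c z u /\ Pair r (h z) (h u) /\ r ∊ a.

Let D_inhabited : inhabited D := st_inhabited mem ST.

Notation definable1 P := (definable (fun e => P (e 0))).
Notation definable2 R := (definable (fun e => R (e 0) (e 1))).

Lemma Pair_inj c a b a' b' :
  Pair c a b -> Pair c a' b' -> (a = a' /\ b = b') \/ (a = b' /\ b = a').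
Proof.
  intros H H'.
  assert (a = a' \/ a = b') by (apply H', H; auto).
  assert (b = a' \/ b = b') by (apply H', H; auto).
  assert (a' = a \/ a' = b) by (apply H, H'; auto).
  assert (b' = a \/ b' = b) by (apply H, H'; auto).
  intuition congruence.
Qed.

(** ** Pulling relations on the power set back to [U] *)

(** The inverse image of an unordered pair does not tell which of its members
    was the first, hence the symmetrized relation. *)
Lemma pull_unordered (R : D -> D -> Prop) : definable2 R ->
  definable2 (fun z u => z ∊ U /\ u ∊ U /\ (R (h z) (h u) \/ R (h u) (h z))).
Proof.
  intros HR.
  destruct (st_power mem ST U) as [P HP], (st_power mem ST P) as [PP HPP].
  destruct (st_sep mem ST (fun c => exists A, A ∊ P /\ exists B, B ∊ P /\ Pair c A B /\ R A B))
    with (a := PP) as [S HS].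
  { unfold Pair. definability. }
  destruct (h_pairs S) as [Q HQ].
  { intros c (_ & A & HA & B & HB & Hc & _)%HS. apply HP in HA, HB. eauto. }
  apply definable_ext with
    (fun e => e 0 ∊ U /\ e 1 ∊ U /\ exists c, c ∊ Q /\ Pair c (e 0) (e 1)).
  { unfold Pair. definability. }
  intros e. generalize (e 0) (e 1). intros z u. clear e.
  split; intros (Hz & Hu & H); split; auto; split; auto.
  - destruct H as (c & Hc & Hp). apply HQ in Hc as (z' & u' & r & _ & _ & Hp' & Hr & HrS).
    apply HS in HrS as (_ & A & _ & B & _ & Hr' & HAB).
    destruct (Pair_inj _ _ _ _ _ Hp Hp') as [[-> ->]|[-> ->]];
    destruct (Pair_inj _ _ _ _ _ Hr Hr') as [[-> ->]|[-> ->]]; auto.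
  - destruct (st_pair mem ST z u) as [c Hc], (st_pair mem ST (h z) (h u)) as [r Hr].
    exists c; split; auto. apply HQ. exists z, u, r. repeat (split; auto).
    apply HS.
    assert (h z ∊ P) by now apply HP, h_sub. assert (h u ∊ P) by now apply HP, h_sub.
    split.
    + apply HPP. intros x [->| ->]%Hr; auto.
    + destruct H as [H|H]; [exists (h z)|exists (h u)]; split; auto;
        [exists (h u)|exists (h z)]; repeat (split; auto); intros Hx;
        specialize (Hr x); tauto.
Qed.

Lemma pull1 (P : D -> Prop) : definable1 P -> definable1 (fun z => z ∊ U /\ P (h z)).
Proof.
  intros HP.
  assert (HR : definable2 (fun A B => P A /\ A = B)) by definability.
  apply pull_unordered in HR.
  eapply definable_ext; [exact (definable_reindex _ _ (fun _ => inl 0) HR)|].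
  intros e; unfold reindex. tauto.
Qed.

(** An unordered pair remembers its order if a definable [K] tells which member
    is the first, or if the order does not matter when both are in [K]. *)
Lemma pull2 (K : D -> Prop) (R : D -> D -> Prop) :
  definable1 K -> definable2 R ->
  (forall A B, R A B -> K A /\ (K B -> R B A)) ->
  definable2 (fun z u => z ∊ U /\ u ∊ U /\ R (h z) (h u)).
Proof.
  intros HK HR HKR. apply pull1 in HK. apply pull_unordered in HR.
  eapply definable_ext.
  - apply definable_and; [|exact HR].
    exact HK.
  - intros e; cbn. split; [|intros (? & ? & H); pose proof (HKR _ _ H); tauto].
    intros ([_ HKz] & Hz & Hu & [H|H]); repeat split; auto.
    destruct (HKR _ _ H). auto.
Qed.

(** [Singleton A a] says [A = {a}], and [Complement A a] says [A = U ∖ {a}]. *)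
Definition Singleton (A a : D) := forall x, x ∊ A <-> x = a.
Definition Complement (A a : D) := forall x, x ∊ A <-> x ∊ U /\ x <> a.
Definition singleton (A : D) := exists a, Singleton A a.

Lemma Singleton_inj A a b : Singleton A a -> Singleton A b -> a = b.
Proof. intros H K. apply K, H. reflexivity. Qed.

Lemma Singleton_ext A B a : Singleton A a -> Singleton B a -> A = B.
Proof. intros H K. apply (st_ext mem ST). intros x. now rewrite (H x), (K x). Qed.

Lemma Complement_inj A a b : a ∊ U -> Complement A a -> Complement A b -> a = b.
Proof.
  intros Ha H K. apply NNPP; intros N. apply (H a); [|reflexivity].
  apply K. auto.
Qed.

Lemma Singleton_exists a : exists A, Singleton A a.
Proof. destruct (st_pair mem ST a a) as [A H]. exists A. intros x. rewrite (H x). tauto. Qed.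

Lemma Complement_exists a : exists A, Complement A a.
Proof.
  destruct (st_sep mem ST (fun x => x <> a)) with (a := U) as [A H].
  { definability. }
  exists A; exact H.
Qed.

Lemma definable_Singleton : definable2 Singleton.
Proof. unfold Singleton. definability. Qed.

Lemma definable_Complement : definable2 Complement.
Proof. unfold Complement. definability. Qed.

Lemma definable_singleton : definable1 singleton.
Proof. unfold singleton, Singleton. definability. Qed.

(** [h] is onto the power set, so [U] has at least three elements: the empty
    set, a singleton and [U] itself have distinct preimages. *)
Lemma Complement_not_singleton A a : Complement A a -> ~ singleton A.
Proof.
  intros HA [b Hb].
  assert (HU : forall x, x ∊ U -> x = a \/ x = b).
  { intros x Hx. destruct (classic (x = a)); auto. right. apply Hb, HA; auto. }
  destruct (st_sep mem ST (fun _ => False)) with (a := U) as [E HE].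
  { apply definable_ext with (fun e : nat -> D => ~ e 0 = e 0); [definability|tauto]. }
  destruct (Singleton_exists b) as [B HB].
  assert (HbU : b ∊ U) by (apply HA, Hb; reflexivity).
  destruct (h_surj E) as (x & Hx & Ex). { intros y Hy. now apply HE in Hy. }
  destruct (h_surj B) as (y & Hy & Ey). { intros z ->%HB; auto. }
  destruct (h_surj U) as (z & Hz & Ez). { intros t; auto. }
  assert (NEB : E <> B). { intros ->. apply (HE b). now apply HB. }
  assert (NEU : E <> U). { intros ->. now apply (HE b). }
  assert (NBU : B <> U).
  { intros ->. apply NEB. rewrite <- Ex, <- Ey. f_equal.
    apply HB in Hx, Hy. congruence. }
  destruct (HU x Hx), (HU y Hy), (HU z Hz); congruence.
Qed.

(** The pair [({a}, {b})] cannot be oriented, as both members are singletons.  So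
    go through [U ∖ {a}], which is not a singleton: both [({a}, U ∖ {a})] and
    [(U ∖ {a}, {b})] can be oriented, and composing the two inverse images gives
    the relation. *)
Lemma pull_singletons (R : D -> D -> Prop) : definable2 R ->
  definable2 (fun z u => z ∊ U /\ u ∊ U /\
    exists a b, Singleton (h z) a /\ Singleton (h u) b /\ R a b).
Proof.
  intros HR.
  assert (HS := definable_Singleton). assert (HC := definable_Complement).
  assert (HK := definable_singleton).
  assert (H1 : definable2 (fun z c => z ∊ U /\ c ∊ U /\
    exists a, a ∊ U /\ Singleton (h z) a /\ Complement (h c) a)).
  { apply (pull2 singleton (fun A C => exists a, a ∊ U /\ Singleton A a /\ Complement C a)).
    - exact HK.
    - definability.
    - intros A C (a & _ & HA & HC'). split; [now exists a|].
      intros HN. now apply Complement_not_singleton in HC'. }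
  assert (H2 : definable2 (fun c u => c ∊ U /\ u ∊ U /\
    exists a b, a ∊ U /\ Complement (h c) a /\ Singleton (h u) b /\ R a b)).
  { apply (pull2 (fun A => ~ singleton A)
      (fun C B => exists a b, a ∊ U /\ Complement C a /\ Singleton B b /\ R a b)).
    - definability.
    - definability.
    - intros C B (a & b & _ & HC' & HB & _). split.
      + now apply Complement_not_singleton in HC'.
      + intros []. now exists b. }
  apply (definable_ext mem) with (fun e => exists c,
    (e 0 ∊ U /\ c ∊ U /\ exists a, a ∊ U /\ Singleton (h (e 0)) a /\ Complement (h c) a) /\
    (c ∊ U /\ e 1 ∊ U /\
       exists a b, a ∊ U /\ Complement (h c) a /\ Singleton (h (e 1)) b /\ R a b)).
  { apply (definable_ex mem (fun c e => _ /\ _)). apply definable_and.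
    - exact (definable_reindex _ _ (scons (inl 1) (fun _ => inl 0)) H1).
    - exact (definable_reindex _ _ (scons (inl 0) (fun _ => inl 2)) H2). }
  intros e. generalize (e 0) (e 1). intros z u. clear e. split.
  - intros (c & (Hz & _ & a & Ha & Sa & Ca) & _ & Hu & a' & b & Ha' & Ca' & Sb & Rab).
    split; auto; split; auto. exists a, b; repeat split; auto; try apply Sa; try apply Sb.
    now rewrite (Complement_inj _ _ _ Ha Ca Ca').
  - intros (Hz & Hu & a & b & Sa & Sb & Rab).
    assert (Ha : a ∊ U) by (apply (h_sub z Hz), Sa; reflexivity).
    destruct (Complement_exists a) as [C HC'].
    destruct (h_surj C) as (c & Hc & <-). { intros x Hx. now apply HC' in Hx. }
    exists c. repeat (split; auto).
    + exists a; auto.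
    + exists a, b; auto.
Qed.

(** ** Iterated singletons of the new membership *)

(** The singleton [{x}] of the relation [y ∊ h x]. *)
Definition iota (x : D) : D :=
  epsilon D_inhabited (fun y => y ∊ U /\ Singleton (h y) x).

Lemma iota_spec x : x ∊ U -> iota x ∊ U /\ Singleton (h (iota x)) x.
Proof.
  intros Hx. unfold iota. apply epsilon_spec.
  destruct (Singleton_exists x) as [A HA].
  destruct (h_surj A) as (y & Hy & <-); [intros z ->%HA; auto|]. eauto.
Qed.

Definition raise (k : nat) (x : D) : D := Nat.iter k iota x.

Lemma raise_in k x : x ∊ U -> raise k x ∊ U.
Proof. intros Hx. induction k; cbn; auto. now apply iota_spec. Qed.

Lemma raise_singleton k x : x ∊ U -> Singleton (h (raise (S k) x)) (raise k x).
Proof. intros Hx. now apply iota_spec, raise_in. Qed.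

Lemma raise_inj k x y : x ∊ U -> y ∊ U -> raise k x = raise k y -> x = y.
Proof.
  intros Hx Hy. induction k as [|k IH]; auto. intros E. apply IH.
  apply (Singleton_inj (h (raise (S k) x))); [now apply raise_singleton|].
  rewrite E. now apply raise_singleton.
Qed.

(** The range of [raise k] on [U] is not given by Separation, [raise] being
    external; this recursion shows it definable. *)
Fixpoint raised (k : nat) (z : D) : Prop :=
  match k with
  | 0 => z ∊ U
  | S k => z ∊ U /\ exists a, Singleton (h z) a /\ raised k a
  end.

Lemma raised_spec k z : raised k z <-> exists x, x ∊ U /\ z = raise k x.
Proof.
  revert z; induction k as [|k IH]; intros z; cbn.
  - split; [eauto|]. now intros (x & Hx & ->).
  - split.
    + intros (Hz & a & Ha & (x & Hx & ->)%IH). exists x; split; auto.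
      destruct (iota_spec (raise k x) (raise_in k x Hx)) as [H K].
      apply h_inj; auto. exact (Singleton_ext _ _ _ Ha K).
    + intros (x & Hx & ->). split; [now apply (raise_in (S k))|].
      exists (raise k x). split; [now apply raise_singleton|]. apply IH; eauto.
Qed.

Lemma definable_raised k : definable1 (raised k).
Proof.
  assert (HS := definable_Singleton).
  induction k as [|k IH]; cbn; [definability|].
  apply (pull1 (fun A => exists a, Singleton A a /\ raised k a)). definability.
Qed.

(** The membership [y ∊ h x], read off [raise (S k) y] and [raise k x]; unlike
    that membership it is definable in the model. *)
Fixpoint mem_at (k : nat) (z u : D) : Prop :=
  match k with
  | 0 => z ∊ U /\ u ∊ U /\ exists a, Singleton (h z) a /\ a ∊ h u
  | S k => z ∊ U /\ u ∊ U /\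
      exists a b, Singleton (h z) a /\ Singleton (h u) b /\ mem_at k a b
  end.

Lemma mem_at_spec k x y : x ∊ U -> y ∊ U ->
  mem_at k (raise (S k) y) (raise k x) <-> y ∊ h x.
Proof.
  intros Hx Hy. induction k as [|k IH].
  - split.
    + intros (_ & _ & a & Ha & K).
      now rewrite (Singleton_inj _ _ _ (raise_singleton 0 y Hy) Ha : y = a).
    + intros K. split; [now apply (raise_in 1)|split; auto].
      exists y; split; auto. now apply (raise_singleton 0).
  - rewrite <- IH. split.
    + intros (_ & _ & a & b & Ha & Hb & K).
      rewrite (Singleton_inj _ _ _ (raise_singleton (S k) y Hy) Ha).
      now rewrite (Singleton_inj _ _ _ (raise_singleton k x Hx) Hb).
    + intros K. split; [now apply (raise_in (S (S k)))|].
      split; [now apply (raise_in (S k))|].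
      exists (raise (S k) y), (raise k x).
      auto using raise_singleton.
Qed.

Lemma definable_mem_at k : definable2 (mem_at k).
Proof.
  assert (HS := definable_Singleton). assert (HK := definable_singleton).
  induction k as [|k IH]; cbn.
  - apply (pull2 singleton (fun A B => exists a, Singleton A a /\ a ∊ B)); auto.
    + definability.
    + intros A B (a & HA & HB). split; [now exists a|]. intros [b Hb].
      apply Hb in HB as ->. exists b; split; auto. now apply HA.
  - now apply pull_singletons.
Qed.

(** ** Stratified formulas *)

Definition carrier := { x | x ∊ U }.

Definition quine : structure Lset :=
  set_structure carrier (fun y x => proj1_sig y ∊ h (proj1_sig x)).

(** A variable of type [i] is raised to the common level [N], by [N - i] steps. *)
Definition level (N : Z) (s : nat -> Z) (x : nat -> carrier) (i : nat) : D :=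
  raise (Z.to_nat (N - s i)) (proj1_sig (x i)).

(** In an atomic formula [t ∈ u] the variable [t] is raised exactly once more than
    [u], so [mem_at] decides it; in [t = u] both are raised equally often. *)
Lemma stratified_definable p : forall s, stratified_by s p ->
  exists N0, forall N, (N0 <= N)%Z -> exists Q, definable Q /\
    forall x, Q (level N s x) <-> sat (M := quine) x p.
Proof.
  induction p as [|t u|t u|[]|p IHp q IHq|p IHp]; intros s Hs; cbn in Hs.
  - exists 0%Z. intros N _. exists (fun e => ~ e 0 = e 0). split; [definability|].
    cbn; tauto.
  - destruct t as [n|[]], u as [m|[]]. cbn in Hs.
    exists 0%Z. intros N _. exists (fun e => e n = e m). split; [definability|].
    intros x. unfold level. rewrite Hs. cbn. split.
    + intros H%raise_inj; try apply proj2_sig. destruct (x n), (x m).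
      now apply subset_eq_compat.
    + now intros ->.
  - destruct t as [n|[]], u as [m|[]]. cbn in Hs.
    exists (s m). intros N HN. set (k := Z.to_nat (N - s m)).
    exists (fun e => mem_at k (e n) (e m)). split.
    { assert (H := definable_mem_at k). definability. }
    intros x. unfold level. fold k.
    replace (Z.to_nat (N - s n)) with (S k) by (subst k; lia).
    apply mem_at_spec; apply proj2_sig.
  - destruct Hs as [Hp Hq]. destruct (IHp s Hp) as [N1 H1], (IHq s Hq) as [N2 H2].
    exists (Z.max N1 N2). intros N HN.
    destruct (H1 N) as (Q1 & D1 & K1), (H2 N) as (Q2 & D2 & K2); try lia.
    exists (fun e => Q1 e -> Q2 e). split; [now apply definable_imp|].
    intros x. cbn. now rewrite K1, K2.
  - destruct Hs as [k Hp]. destruct (IHp _ Hp) as [N0 H0]. exists N0. intros N HN.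
    destruct (H0 N HN) as (Q & DQ & KQ).
    set (m := Z.to_nat (N - k)).
    exists (fun e => forall z, raised m z -> Q (scons z e)). split.
    { apply (definable_all mem (fun z e => raised m z -> Q (scons z e))).
      apply definable_imp; [apply definable_raised|].
      apply definable_ext with Q; auto. intros e. now rewrite scons_eta. }
    intros x. cbn.
    assert (K : forall z : carrier,
      Q (scons (raise m (proj1_sig z)) (level N s x)) <-> sat (M := quine) (scons z x) p).
    { intros z. rewrite <- KQ.
      match goal with |- Q ?a <-> Q ?b => replace a with b; [reflexivity|] end.
      extensionality i; now destruct i. }
    split.
    + intros H z. apply K, H. apply raised_spec. exists (proj1_sig z).
      split; auto. apply proj2_sig.
    + intros H z (w & Hw & ->)%raised_spec. apply (K (exist _ w Hw)), H.
Qed.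

(** Images of sets under [h] exist, so a set of iterated singletons can be
    lowered again. *)
Lemma lower k (P : D -> Prop) A :
  (forall w, w ∊ A <-> exists z, z ∊ U /\ P z /\ w = raise k z) ->
  exists B, forall z, z ∊ B <-> z ∊ U /\ P z.
Proof.
  revert A; induction k as [|k IH]; intros A HA.
  - exists A. intros z. rewrite HA. split; [now intros (? & ? & ? & ->)|].
    intros []. exists z; auto.
  - destruct (h_image A) as [B HB].
    { intros w (z & Hz & _ & ->)%HA. now apply raise_in. }
    destruct (st_union mem ST B) as [C HC].
    apply (IH C). intros w. rewrite HC. split.
    + intros (y & (x & (z & Hz & Pz & ->)%HA & ->)%HB & Hw).
      exists z; repeat split; auto. now apply (raise_singleton k z Hz).
    + intros (z & Hz & Pz & ->). exists (h (raise (S k) z)). split.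
      * apply HB. exists (raise (S k) z); split; auto. apply HA; eauto.
      * now apply raise_singleton.
Qed.

Lemma quine_comprehension p (x : nat -> carrier) : stratified p ->
  exists y : carrier, forall z : carrier,
    mem_of (s := quine) z y <-> sat (M := quine) (scons z x) p.
Proof.
  intros [s Hs]. destruct (stratified_definable p s Hs) as [N H].
  destruct (H N (Z.le_refl N)) as (Q & DQ & KQ). clear H.
  set (k := Z.to_nat (N - s 0)).
  (* The parameters: [e i] is [x i] raised from the type of variable [i + 1]; the
     entry [x 0] at the head is a filler. *)
  pose (e := fun i => level N s (scons (x 0) x) (S i)).
  assert (DP : definable1 (fun w => raised k w /\ Q (scons w e))).
  { apply definable_and; [apply definable_raised|].
    eapply definable_ext.
    - exact (definable_reindex mem Q (scons (inl 0) (fun i => inr (e i))) DQ).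
    - intros e'. unfold reindex.
      match goal with |- Q ?a <-> Q ?b => replace a with b; [reflexivity|] end.
      extensionality i; now destruct i. }
  destruct (st_sep mem ST _ DP U) as [A HA].
  destruct (lower k (fun z => Q (scons (raise k z) e)) A) as [B HB].
  { intros w. rewrite HA, raised_spec. split.
    - intros (_ & (z & Hz & ->) & K). eauto.
    - intros (z & Hz & K & ->). split; [now apply raise_in|eauto]. }
  destruct (h_surj B) as (y & Hy & Ey). { intros z Hz. now apply HB in Hz. }
  exists (exist _ y Hy). intros [z Hz]. cbn. rewrite Ey, HB, <- KQ.
  match goal with |- _ /\ Q ?a <-> Q ?b => replace b with a; [tauto|] end.
  extensionality i; now destruct i.
Qed.

Theorem quine_NF : model quine NF.
Proof.
  intros p [|p' c Hp Hc].
  - intros e. unfold Extensionality. intros [a Ha] [b Hb] H.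
    cbn in *. apply subset_eq_compat. apply h_inj; auto.
    apply (st_ext mem ST). intros z. split; intros Hz.
    + assert (Hz' := h_sub a Ha z Hz). specialize (H (exist _ z Hz')). cbn in H. tauto.
    + assert (Hz' := h_sub b Hb z Hz). specialize (H (exist _ z Hz')). cbn in H. tauto.
  - apply (proj1 (sat_closure _ _ Hc)). intros e. unfold Comprehension.
    rewrite sat_Ex. destruct (quine_comprehension p' e Hp) as [y Hy].
    exists y. rewrite sat_All. intros z. rewrite sat_Iff, sat_subst.
    apply (iff_trans (Hy z)).
    match goal with |- sat ?a _ <-> sat ?b _ => replace b with a; [reflexivity|] end.
    extensionality i; destruct i as [|i]; cbn; auto.
    now replace (i + 2) with (S (S i)) by lia.
Qed.

End PowerBijection.

(** * Models of T *)

Section ModelsOfT.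
Context (M : structure LT) (HM : model M T).
Notation mem := (mem_of (s := M)).
Notation F := (rel_of (s := M) f_sym).
Notation J := (fun_of (s := M) j_sym).
Notation "x ∊ y" := (mem x y) (at level 70).

Lemma sat_embed p (e : nat -> M) :
  sat e (embed p) <-> sat (M := set_structure M mem) e p.
Proof.
  assert (HT : forall e t, eval (M := M) e (embed_term t) = eval (M := set_structure M mem) e t).
  { intros ? [n|[]]; reflexivity. }
  revert e; induction p as [|t u|t u|[]|p IHp q IHq|p IHp]; intros e; cbn.
  - reflexivity.
  - now rewrite !HT.
  - now rewrite !HT.
  - now rewrite IHp, IHq.
  - now apply all_iff.
Qed.

Lemma reduct_set_theory : inhabited M -> set_theory mem.
Proof.
  intros HI. apply set_theory_of_model; auto.
  intros p Hp e. apply sat_embed, HM. now constructor.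
Qed.

Lemma F_functional x y z : F x y -> F x z -> y = z.
Proof. exact (HM _ T_f_functional (fun _ => x) x y z). Qed.

Lemma F_injective x y z : F x z -> F y z -> x = y.
Proof. exact (HM _ T_f_injective (fun _ => x) x y z). Qed.

Lemma J_automorphism : automorphism mem J.
Proof.
  split; [|split].
  - intros x. exact (HM _ T_j_injective (fun _ => x) x).
  - intros x. assert (H : sat (M := M) (scons x (fun _ => x)) (Ex (Eq (j (Var 0)) (Var 1))))
      by exact (HM _ T_j_surjective (fun _ => x) x).
    now rewrite sat_Ex in H.
  - intros x y. assert (H : sat (M := M) (scons y (scons x (fun _ => x)))
        (Iff (Mem (Var 1) (Var 0)) (Mem (j (Var 1)) (j (Var 0)))))
      by exact (HM _ T_j_mem (fun _ => x) x y).
    now rewrite sat_Iff in H.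
Qed.

Lemma J_image a : exists b, forall y, y ∊ b <-> exists x, x ∊ a /\ y = J x.
Proof.
  revert a. enough (K : forall e, sat (M := M) e j_image <-> forall a, exists b,
    forall y, y ∊ b <-> exists x, x ∊ a /\ y = J x)
    by (intros a; exact (proj1 (K (fun _ => a)) (HM _ T_j_image _) a)).
  intros e. unfold j_image, ExIn. sat_unfold.
Qed.

Lemma J_preimage a : exists b, forall x, x ∊ b <-> J x ∊ a.
Proof.
  revert a. enough (K : forall e, sat (M := M) e j_preimage <-> forall a, exists b,
    forall x, x ∊ b <-> J x ∊ a)
    by (intros a; exact (proj1 (K (fun _ => a)) (HM _ T_j_preimage _) a)).
  intros e. unfold j_preimage. sat_unfold.
Qed.

Lemma J_Subset a b : Subset mem a b <-> Subset mem (J a) (J b).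
Proof.
  destruct J_automorphism as (Ji & Js & Jm). split; intros H x Hx.
  - destruct (Js x) as [y <-]. apply (proj1 (Jm _ _)), H, (proj2 (Jm _ _)), Hx.
  - apply (proj2 (Jm _ _)), H, (proj1 (Jm _ _)), Hx.
Qed.

Lemma J_Pair c a b : Pair mem c a b <-> Pair mem (J c) (J a) (J b).
Proof.
  destruct J_automorphism as (Ji & Js & Jm). split; intros H x.
  - destruct (Js x) as [y <-]. rewrite <- Jm, (H y).
    split; (intros [E|E]; [left|right]); try apply Ji; congruence.
  - rewrite (Jm x c), (H (J x)).
    split; (intros [E|E]; [left|right]); try apply Ji; congruence.
Qed.

Lemma sat_in_V (e : nat -> M) : sat e in_V <-> exists v, IsV mem (e 1) v /\ e 0 ∊ v.
Proof.
  unfold in_V. rewrite sat_Ex. apply ex_iff; intros v.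
  rewrite sat_And, sat_is_V. reflexivity.
Qed.

Lemma sat_mem' (e : nat -> M) : sat e mem' <-> exists w, F (e 1) (J w) /\ e 0 ∊ w.
Proof. unfold mem'. sat_unfold. Qed.

(** The interpretation evaluates formulas in the structure [quine mem U h]. *)
Lemma sat_translate a U h p :
  (forall x, (exists v, IsV mem a v /\ x ∊ v) <-> x ∊ U) ->
  (forall x y, x ∊ U -> (exists w, F x (J w) /\ y ∊ w) <-> y ∊ h x) ->
  forall n (e : nat -> M) (v : nat -> carrier mem U) t,
  below n p -> (forall i, i < n -> e i = proj1_sig (v i)) -> eval e t = a ->
  sat e (translate in_V mem' t p) <-> sat (M := quine mem U h) v p.
Proof.
  intros HV HE. induction p as [|t u|t u|[]|p IHp q IHq|p IHp];
    intros n e v b Hn Hev Hb; cbn [translate below] in *.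
  - reflexivity.
  - destruct t as [i|[]], u as [k|[]]. cbn in *. rewrite (Hev i), (Hev k) by tauto.
    split; [|congruence]. intros E. destruct (v i), (v k). now apply subset_eq_compat.
  - destruct t as [i|[]], u as [k|[]]. cbn in Hn.
    unfold inst. rewrite sat_subst, sat_mem'. cbn. rewrite (Hev i), (Hev k) by tauto.
    apply HE, proj2_sig.
  - cbn. now rewrite (IHp n e v), (IHq n e v) by tauto.
  - cbn [sat].
    assert (K : forall x, sat (scons x e) (inst [Var 0; lift 1 b] in_V) <-> x ∊ U).
    { intros x. unfold inst. rewrite sat_subst, sat_in_V. cbn -[lift].
      now rewrite eval_lift1, Hb. }
    assert (K' : forall x : carrier mem U,
      sat (scons (proj1_sig x) e) (translate in_V mem' (lift 1 b) p) <->
      sat (M := quine mem U h) (scons x v) p).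
    { intros x. apply IHp with (S n); auto.
      - intros [|i] Hi; cbn; auto. apply Hev; lia.
      - now rewrite eval_lift1. }
    split.
    + intros H x. apply K', H, K, proj2_sig.
    + intros H x Hx%K. apply (K' (exist _ x Hx)), H.
Qed.

(** [f] maps [U] onto the power set of [j(U)], and [j⁻¹] maps that onto the power
    set of [U].  Amenability of [h] combines that of [f] on subsets of [U] and on
    pairs with that of [j]. *)
Lemma movement_bijection a :
  MovementWitness mem F J a -> exists U h,
    (forall x, (exists v, IsV mem a v /\ x ∊ v) <-> x ∊ U) /\
    (forall x y, x ∊ U -> (exists w, F x (J w) /\ y ∊ w) <-> y ∊ h x) /\
    (exists x, x ∊ U) /\
    model (quine mem U h) NF.
Proof.
  intros ([[Ta _] _] & U & s & W & HU & Hs & HW & _ & [Ftot Fonto] & Fimg & Fpairs).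
  assert (HI : inhabited M) by now exists.
  assert (ST := reduct_set_theory HI).
  destruct J_automorphism as (Ji & Js & Jm).
  assert (Ja := J_automorphism).
  assert (PW : forall x, x ∊ W <-> Subset mem x (J U)).
  { apply (V_succ mem ST (J a) s (J U) W); auto.
    - now apply automorphism_Transitive.
    - now apply automorphism_IsV. }
  pose (h := fun x => epsilon HI (fun w => F x (J w))).
  assert (Hh : forall x, x ∊ U -> F x (J (h x))).
  { intros x Hx. apply (epsilon_spec HI (fun w => F x (J w))).
    destruct (Ftot x Hx) as [y Hy], (Js y) as [w <-]. eauto. }
  assert (hF : forall x w, x ∊ U -> F x (J w) -> w = h x).
  { intros x w Hx Hw. apply Ji. eapply F_functional; eauto. }
  assert (FU : forall x w, F x (J w) -> Subset mem w U -> x ∊ U).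
  { intros x w Hx Hw. apply J_Subset, PW, Fonto in Hw as (x' & Hx' & Hw').
    now rewrite (F_injective _ _ _ Hx Hw'). }
  assert (h_sub : forall x, x ∊ U -> Subset mem (h x) U).
  { intros x Hx. apply J_Subset, PW, Fonto. eauto. }
  assert (h_surj : forall w, Subset mem w U -> exists x, x ∊ U /\ h x = w).
  { intros w Hw. assert (Hw' := Hw). apply J_Subset, PW, Fonto in Hw' as (x & Hx & Hxw).
    exists x; split; auto. symmetry; auto. }
  exists U, h. split; [|split; [|split]].
  - intros x. split; [|eauto]. intros (v & Hv & Hx).
    now rewrite (V_unique mem ST a U v Ta HU Hv).
  - intros x y Hx. split; [|eauto]. intros (w & Hw & Hy).
    now rewrite <- (hF x w Hx Hw).
  - destruct (h_surj U) as (x & Hx & _); [now intros x|eauto].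
  - apply (quine_NF mem ST U h); auto.
    + intros x y Hx Hy E. apply (F_injective _ _ (J (h x))); auto. rewrite E; auto.
    + intros b Hb. destruct (Fimg b Hb) as [c Hc], (J_preimage c) as [d Hd].
      exists d. intros w. rewrite Hd, Hc. apply ex_iff. intros x.
      split; intros [Hx Hw]; split; auto. subst; auto.
    + intros b Hb. destruct (J_image b) as [c Hc].
      destruct (Fpairs c) as [d Hd].
      { intros y (x & Hx & ->)%Hc. destruct (Hb x Hx) as (A & HA & B & HB & Hp).
        exists (J A). split; [now apply PW, (proj1 (J_Subset _ _))|].
        exists (J B). split; [now apply PW, (proj1 (J_Subset _ _))|].
        now apply (proj1 (J_Pair _ _ _)). }
      exists d. intros y. rewrite Hd. split.
      * intros (z & u & p & q & r & Hy & Hz & Hu & Hr & (r' & Hr' & ->)%Hc).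
        destruct (Hb r' Hr') as (A & HA & B & HB & Hp).
        destruct (Pair_inj mem _ _ _ _ _ Hr (proj1 (J_Pair _ _ _) Hp)) as [[-> ->]|[-> ->]].
        -- assert (Uz := FU _ _ Hz HA). assert (Uu := FU _ _ Hu HB).
           exists z, u, r'. rewrite <- (hF z A), <- (hF u B); auto.
        -- assert (Uz := FU _ _ Hz HB). assert (Uu := FU _ _ Hu HA).
           exists z, u, r'. rewrite <- (hF z B), <- (hF u A); auto.
           repeat (split; [assumption|]). split; [|assumption].
           now apply (proj2 (J_Pair _ _ _)).
      * intros (z & u & r & Hz & Hu & Hy & Hr & Hrb).
        exists z, u, (J (h z)), (J (h u)), (J r). repeat (split; auto).
        -- apply (proj1 (J_Pair _ _ _) Hr).
        -- apply (proj1 (J_Pair _ _ _) Hr).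
        -- apply Hc. eauto.
Qed.

End ModelsOfT.

Lemma below_embed_term {L} n t : below_term n t -> below_term n (@embed_term L t).
Proof. destruct t as [|[]]; auto. Qed.

Lemma below_embed {L} n p : below n p -> below n (@embed L p).
Proof.
  revert n; induction p as [|t u|t u|[]|p IHp q IHq|p IHp]; intros n; cbn; auto;
    intros []; auto using below_embed_term.
Qed.

Ltac concrete_below := cbn; repeat split; lia.

Lemma NF_closed p : NF p -> below 0 p.
Proof.
  intros [|q c _ Hc]; [concrete_below|]. now apply below_closure in Hc.
Qed.

Lemma T_closed p : T p -> below 0 p.
Proof.
  intros [q Hq| | | | | | | |]; try concrete_below.
  apply below_embed. destruct Hq as [| | | | | |? ? Hc|? ? Hc]; try concrete_below;
    now apply below_closure in Hc.
Qed.

Definition code_j (_ : fsym LT) : nat := 0.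
Definition code_f (_ : rsym LT) : nat := 0.

Lemma code_j_inj x y : code_j x = code_j y -> x = y.
Proof. now destruct x, y. Qed.

Lemma code_f_inj x y : code_f x = code_f y -> x = y.
Proof. now destruct x, y. Qed.

Lemma proves_of_models p :
  (forall M : structure LT, model M T -> forall e : nat -> M, sat e p) -> proves T p.
Proof. exact (completeness code_j code_f code_j_inj code_f_inj T p T_closed). Qed.

Lemma movement_proves_NF p : NF p ->
  proves T (All (Imp (movement_witness (Var 0)) (translate in_V mem' (Var 0) p))).
Proof.
  intros Hp. apply proves_of_models. intros M HM e a.
  rewrite sat_Imp, sat_movement_witness. intros Ha.
  destruct (movement_bijection M HM a Ha) as (U & h & HV & HE & [x Hx] & HN).
  apply (sat_translate M a U h p HV HE 0 _ (fun _ => exist _ x Hx)); auto.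
  - now apply NF_closed.
  - intros; lia.
Qed.

Theorem mainTheorem1 :
  interprets T NF /\
  (forall p, NF p ->
     proves T (All (Imp (movement_witness (Var 0))
                        (translate in_V mem' (Var 0) p)))) /\
  (consistent T -> consistent NF).
Proof.
  split; [|split].
  - exists (movement_witness (Var 0)), in_V, mem'. split; [|split; [|split]].
    + concrete_below.
    + apply proves_ax, T_movement.
    + apply proves_of_models. intros M HM e a.
      rewrite sat_Imp, sat_movement_witness, sat_Ex. intros Ha.
      destruct (movement_bijection M HM a Ha) as (U & h & HV & _ & [x Hx] & _).
      exists x. apply sat_in_V, HV, Hx.
    + exact movement_proves_NF.
  - exact movement_proves_NF.
  - intros HT.
    destruct (model_existence code_j code_f code_j_inj code_f_inj 0 T T_closed HT)
      as (M & e & He).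
    assert (HM : model M T).
    { intros q Hq e'. apply (sat_below e e' q 0); auto; [now apply T_closed|intros; lia]. }
    destruct (proj1 (sat_Ex _ _) (HM _ T_movement e)) as [a Ha%sat_movement_witness].
    destruct (movement_bijection M HM a Ha) as (U & h & _ & _ & [x Hx] & HN).
    exact (model_consistent (quine mem_of U h) NF (exist _ x Hx) HN).
Qed.
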